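(* Let $\alpha\in\mathbb{R}$, let $L$ be slowly varying at the origin (resp. at infinity), and let $\mathbf{f}\in\mathcal{S}'(\mathbb{R}^{n},E)$. If $\mathbf{f}$ is quasiasymptotically bounded of degree $\alpha$ at the origin (resp. at infinity) with respect to $L$ in the space $\mathcal{D}'(\mathbb{R}^{n},E)$, then $\mathbf{f}$ is quasiasymptotically bounded of degree $\alpha$ at the origin (resp. at infinity) with respect to $L$ in the space $\mathcal{S}'(\mathbb{R}^{n},E)$.
   Context: $E$ is a Banach space with norm $\|\cdot\|$. For $\mathcal{A}=\mathcal{D}$ or $\mathcal{S}$, $\mathcal{A}'(\mathbb{R}^{n},E)$ is the space of continuous linear mappings $\mathcal{A}(\mathbb{R}^{n})\to E$. A positive measurable function $L$ on an interval $(0,A)$ (resp. $(A,\infty)$) is slowly varying at the origin (resp. at infinity) if $\lim_{\lambda\to0^{+}}L(a\lambda)/L(\lambda)=1$ (resp. $\lim_{\lambda\to\infty}$) for each $a>0$. $\mathbf{f}$ is quasiasymptotically bounded of degree $\alpha$ at the origin (resp. at infinity) with respect to $L$ in $\mathcal{A}'(\mathbb{R}^{n},E)$ if for each $\phi\in\mathcal{A}(\mathbb{R}^{n})$, $\limsup_{\lambda\to0^{+}}\frac{1}{\lambda^{\alpha}L(\lambda)}\|\langle\mathbf{f}(\lambda t),\phi(t)\rangle\|<\infty$ (resp. $\limsup_{\lambda\to\infty}$), where $\langle\mathbf{f}(\lambda t),\phi(t)\rangle=\lambda^{-n}\langle\mathbf{f}(t),\phi(t/\lambda)\rangle$. *)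

(* Defs.v *)
From HB Require Import structures.
From mathcomp Require Import all_boot all_order all_algebra.
From mathcomp Require Import complex lra.
From mathcomp Require Import all_classical all_reals all_analysis measurable_realfun.

Set Implicit Arguments.
Unset Strict Implicit.
Unset Printing Implicit Defensive.

Import Order.TTheory GRing.Theory Num.Theory.
Import numFieldNormedType.Exports.

Local Open Scope classical_set_scope.
Local Open Scope ring_scope.
Local Open Scope complex_scope.

Local Notation Re := (@complex.Re _).
Local Notation Im := (@complex.Im _).
Local Notation normc := Normc.normc.

Section SmoothFunctions.
Context {R : realType} {n : nat}.
Implicit Types (phi psi : 'rV[R]_n -> R[i]) (s : seq 'I_n).

Definition partial (j : 'I_n) phi : 'rV[R]_n -> R[i] := fun x =>
  ('D_(delta_mx 0 j) (fun y => Re (phi y)) x) +i*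
  ('D_(delta_mx 0 j) (fun y => Im (phi y)) x).

(* A differential operator of order [size s], given by the sequence of the
   directions of its successive derivatives (several sequences represent the
   same multi-index, which is harmless since all of them are used below). *)
Definition partials s phi : 'rV[R]_n -> R[i] := foldr partial phi s.

Definition smooth phi := forall s,
  [/\ continuous (fun x => Re (partials s phi x)),
      continuous (fun x => Im (partials s phi x)) &
      forall (j : 'I_n) (x : 'rV[R]_n),
        derivable (fun y => Re (partials s phi y)) x (delta_mx 0 j) /\
        derivable (fun y => Im (partials s phi y)) x (delta_mx 0 j)].

Definition supp phi : set 'rV[R]_n := closure [set x | phi x != 0].

Definition is_test phi := smooth phi /\ compact (supp phi).

Definition is_schwartz phi := smooth phi /\
  forall (N : nat) s, exists M : R, forall x : 'rV[R]_n,
    (1 + `|x|) ^+ N * normc (partials s phi x) <= M.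

(* t |-> phi (t / l); the value at l = 0 is irrelevant. *)
Definition dilation (l : R) phi : 'rV[R]_n -> R[i] :=
  if l == 0 then 0 else fun t => phi (l^-1 *: t).

Lemma is_derive_comb (a b : R) (f g h : 'rV[R]_n -> R) (x v : 'rV[R]_n) :
  derivable f x v -> derivable g x v -> derivable h x v ->
  is_derive x v (a *: f + b *: g + h) (a * 'D_v f x + b * 'D_v g x + 'D_v h x).
Proof.
move=> /derivableP df /derivableP dg /derivableP dh.
exact: (is_deriveD (is_deriveD (is_deriveZ a df) (is_deriveZ b dg)) dh).
Qed.

Lemma continuous_comb (T : topologicalType) (a b : R) (f g h : T -> R) :
  continuous f -> continuous g -> continuous h ->
  continuous (a *: f + b *: g + h).
Proof.
move=> cf cg ch x.
apply: cvgD; last exact: ch.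
by apply: cvgD; apply: cvgZl_tmp; [exact: cf|exact: cg].
Qed.

Lemma continuous_scale (T : topologicalType) (a : R) (f : T -> R) :
  continuous f -> continuous (a *: f).
Proof. by move=> cf x; apply: cvgZl_tmp; exact: cf. Qed.

Lemma continuous_compose (T U V : topologicalType) (f : T -> U) (g : U -> V) :
  continuous f -> continuous g -> continuous (fun x => g (f x)).
Proof. by move=> cf cg x; apply: continuous_comp; [exact: cf|exact: cg]. Qed.

Lemma Re_comb (a : R[i]) phi psi :
  (fun y => Re ((a *: phi + psi) y)) =
  Re a *: (fun y => Re (phi y)) + (- Im a) *: (fun y => Im (phi y)) +
  (fun y => Re (psi y)).
Proof.
case: a => a b; apply/funext => y; rewrite !fctE /=.
by case: (phi y) => ? ?; case: (psi y) => ? ? /=; rewrite /GRing.scale /= mulNr.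
Qed.

Lemma Im_comb (a : R[i]) phi psi :
  (fun y => Im ((a *: phi + psi) y)) =
  Re a *: (fun y => Im (phi y)) + Im a *: (fun y => Re (phi y)) +
  (fun y => Im (psi y)).
Proof.
case: a => a b; apply/funext => y; rewrite !fctE /=.
by case: (phi y) => ? ?; case: (psi y) => ? ?.
Qed.

Lemma partials_lin (a : R[i]) phi psi : smooth phi -> smooth psi ->
  forall s, partials s (a *: phi + psi) = a *: partials s phi + partials s psi.
Proof.
move=> sp sq; elim=> [//|j s IH] /=; rewrite IH.
have [_ _ dp] := sp s; have [_ _ dq] := sq s.
apply/funext => x; have [p1 p2] := dp j x; have [q1 q2] := dq j x.
rewrite /partial Re_comb Im_comb.
rewrite (@derive_val _ _ _ _ _ _ _ (is_derive_comb (Re a) (- Im a) p1 p2 q1)).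
rewrite (@derive_val _ _ _ _ _ _ _ (is_derive_comb (Re a) (Im a) p2 p1 q2)).
by case: a {IH} => a b; rewrite !fctE /=; congr (_ +i* _); rewrite /= mulNr.
Qed.

Lemma smooth_lin (a : R[i]) phi psi :
  smooth phi -> smooth psi -> smooth (a *: phi + psi).
Proof.
move=> sp sq s; rewrite partials_lin// Re_comb Im_comb.
have [cp1 cp2 dp] := sp s; have [cq1 cq2 dq] := sq s.
split; [exact: continuous_comb|exact: continuous_comb|].
move=> j x; have [p1 p2] := dp j x; have [q1 q2] := dq j x; split.
  exact: (@ex_derive _ _ _ _ _ _ _ (is_derive_comb (Re a) (- Im a) p1 p2 q1)).
exact: (@ex_derive _ _ _ _ _ _ _ (is_derive_comb (Re a) (Im a) p2 p1 q2)).
Qed.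

Lemma partials0 s : partials s (0 : 'rV[R]_n -> R[i]) = 0.
Proof.
elim: s => [//|j s IH] /=; rewrite IH.
apply/funext => x; rewrite /partial /=.
by rewrite (_ : (fun=> 0) = cst 0)// !derive_cst.
Qed.

Lemma smooth0 : smooth (0 : 'rV[R]_n -> R[i]).
Proof.
move=> s; rewrite partials0; split.
- exact: (@cst_continuous _ _ (0 : R)).
- exact: (@cst_continuous _ _ (0 : R)).
by move=> j x; split; exact: (@derivable_cst _ _ _ (0 : R)).
Qed.

Lemma compact_supp (K : set 'rV[R]_n) phi :
  compact K -> [set x | phi x != 0] `<=` K -> compact (supp phi).
Proof.
move=> cK sK; have clK : closed K.
  by apply: compact_closed => //; exact: norm_hausdorff.
apply: (subclosed_compact _ cK); first exact: closed_closure.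
by rewrite (closure_id K).1//; exact: closure_subset.
Qed.

Lemma normc_comb (a b z w : R[i]) :
  normc (a * z + b * w) <= normc a * normc z + normc b * normc w.
Proof. by rewrite -!Normc.normcM; exact: le_normcD. Qed.

Lemma normc_ge0 (z : R[i]) : 0 <= normc z.
Proof. by case: z => a b; exact: sqrtr_ge0. Qed.

Lemma schwartz_lin (a : R[i]) phi psi :
  is_schwartz phi -> is_schwartz psi -> is_schwartz (a *: phi + psi).
Proof.
move=> [sp dp] [sq dq]; split; first exact: smooth_lin.
move=> N s; have [M1 h1] := dp N s; have [M2 h2] := dq N s.
exists (normc a * M1 + M2) => x; rewrite partials_lin//.
set p := partials s phi in h1 *; set q := partials s psi in h2 *.
have w0 : 0 <= (1 + `|x|) ^+ N by rewrite exprn_ge0// addr_ge0.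
have le := normc_comb a 1 (p x) (q x).
rewrite Normc.normc1 !mul1r in le.
apply: (le_trans (ler_wpM2l w0 le)).
rewrite mulrDr mulrCA lerD ?h2// ler_wpM2l ?normc_ge0//; exact: h1.
Qed.

Lemma schwartz0 : is_schwartz (0 : 'rV[R]_n -> R[i]).
Proof.
split; first exact: smooth0.
by move=> N s; exists 0 => x; rewrite partials0 Normc.normc0 mulr0.
Qed.

Lemma test_lin (a : R[i]) phi psi :
  is_test phi -> is_test psi -> is_test (a *: phi + psi).
Proof.
move=> [sp kp] [sq kq]; split; first exact: smooth_lin.
apply: (compact_supp (compactU kp kq)) => x /= nz.
have [p0|p0] := eqVneq (phi x) 0; last by left; exact: subset_closure.
right; apply: subset_closure => /=; apply: contra nz => /eqP q0.
by rewrite !fctE p0 q0 addr0 scaler0.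
Qed.

Lemma test0 : is_test (0 : 'rV[R]_n -> R[i]).
Proof.
split; first exact: smooth0.
by apply: (compact_supp (@compact0 _)) => x /=; rewrite eqxx.
Qed.

Lemma is_derive_dil (c : R) (f : 'rV[R]_n -> R) (x v : 'rV[R]_n) :
  c != 0 -> derivable f (c *: x) v ->
  is_derive x v (fun t => f (c *: t)) (c * 'D_v f (c *: x)).
Proof.
move=> c0 df.
suff cv : (fun h => h^-1 *: (((fun t => f (c *: t)) \o shift x) (h *: v) -
    f (c *: x))) @ 0^' --> c * 'D_v f (c *: x).
  apply: DeriveDef; first by apply/cvg_ex; eexists; exact: cv.
  by apply: cvg_lim cv; exact: norm_hausdorff.
have -> : (fun h => h^-1 *: (((fun t => f (c *: t)) \o shift x) (h *: v) -
    f (c *: x))) =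
  c *: ((fun k => k^-1 *: ((f \o shift (c *: x)) (k *: v) - f (c *: x))) \o
    (fun h => c * h)).
  apply/funext => h; rewrite !fctE /= (scalerDr c (h *: v)) [c *: (h *: v)]scalerA.
  by rewrite /GRing.scale/= invfM !mulrA mulfV// mul1r.
apply: cvgZl_tmp; apply: cvg_comp df.
move=> A /= [e /= e0 Ae]; exists (e / `|c|) => /=.
  by rewrite divr_gt0 ?normr_gt0.
move=> h /=; rewrite sub0r normrN => he h0; apply: Ae => /=.
  by rewrite sub0r normrN normrM mulrC -ltr_pdivlMr ?normr_gt0.
by rewrite mulf_neq0.
Qed.

Lemma partials_dil (c : R) phi : c != 0 -> smooth phi -> forall s,
  partials s (fun t => phi (c *: t)) =
  fun t => (c ^+ size s)%:C * partials s phi (c *: t).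
Proof.
move=> c0 sp; elim=> [|j s IH] /=; first by apply/funext => t; rewrite mul1r.
rewrite IH; have [_ _ dp] := sp s; apply/funext => x.
have [p1 p2] := dp j (c *: x).
set p := partials s phi in p1 p2 *; rewrite /partial.
have -> : (fun y => Re ((c ^+ size s)%:C * p (c *: y))) =
    c ^+ size s *: (fun y => Re (p (c *: y))).
  by apply/funext => y; rewrite !fctE; case: (p _) => ? ? /=; rewrite mul0r subr0.
have -> : (fun y => Im ((c ^+ size s)%:C * p (c *: y))) =
    c ^+ size s *: (fun y => Im (p (c *: y))).
  by apply/funext => y; rewrite !fctE; case: (p _) => ? ? /=; rewrite mul0r addr0.
rewrite (@derive_val _ _ _ _ _ _ _ (is_deriveZ _ (is_derive_dil c0 p1))).
rewrite (@derive_val _ _ _ _ _ _ _ (is_deriveZ _ (is_derive_dil c0 p2))).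
by congr (_ +i* _); rewrite !mul0r ?subr0 ?addr0 exprSr /GRing.scale/= mulrA.
Qed.

Lemma smooth_dil (c : R) phi :
  c != 0 -> smooth phi -> smooth (fun t => phi (c *: t)).
Proof.
move=> c0 sp s; rewrite partials_dil//; have [cp1 cp2 dp] := sp s.
set p := partials s phi in cp1 cp2 dp *.
have -> : (fun y => Re ((c ^+ size s)%:C * p (c *: y))) =
    c ^+ size s *: (fun y => Re (p (c *: y))).
  by apply/funext => y; rewrite !fctE; case: (p _) => ? ? /=; rewrite mul0r subr0.
have -> : (fun y => Im ((c ^+ size s)%:C * p (c *: y))) =
    c ^+ size s *: (fun y => Im (p (c *: y))).
  by apply/funext => y; rewrite !fctE; case: (p _) => ? ? /=; rewrite mul0r addr0.
have cc : continuous (fun x : 'rV[R]_n => c *: x) by exact: scaler_continuous.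
split.
- exact: (continuous_scale (continuous_compose cc cp1)).
- exact: (continuous_scale (continuous_compose cc cp2)).
move=> j x; have [p1 p2] := dp j (c *: x); split; apply: derivableZ.
  exact: (@ex_derive _ _ _ _ _ _ _ (is_derive_dil c0 p1)).
exact: (@ex_derive _ _ _ _ _ _ _ (is_derive_dil c0 p2)).
Qed.

Lemma schwartz_dil (l : R) phi : is_schwartz phi -> is_schwartz (dilation l phi).
Proof.
rewrite /dilation; case: (eqVneq l 0) => [_ _|l0 [sp dp]]; first exact: schwartz0.
have c0 : l^-1 != 0 by rewrite invr_eq0.
split; first exact: smooth_dil.
move=> N s; have [M hM] := dp N s.
exists ((1 + `|l|) ^+ N * (normc (l^-1 ^+ size s)%:C * M)) => x.
rewrite partials_dil//= Normc.normcM.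
set p := partials s phi (l^-1 *: x).
have wx : 1 + `|x| <= (1 + `|l|) * (1 + `|l^-1 *: x|).
  have <- : `|l| * `|l^-1 *: x| = `|x|.
    by rewrite normrZ mulrA -normrM mulfV// normr1 mul1r.
  have := normr_ge0 l; have := normr_ge0 (l^-1 *: x).
  by move: `|_ *: x| `|l| => u w; lra.
have h1 : 0 <= 1 + `|x| by rewrite addr_ge0.
have h2 : 0 <= 1 + `|l| by rewrite addr_ge0.
have le := lerXn2r N h1 (le_trans h1 wx) wx.
apply: (@le_trans _ _ (((1 + `|l|) * (1 + `|l^-1 *: x|)) ^+ N *
   (normc (l^-1 ^+ size s)%:C * normc p))).
  by rewrite ler_wpM2r// mulr_ge0// normc_ge0.
by rewrite exprMn -mulrA ler_wpM2l ?exprn_ge0// mulrCA ler_wpM2l ?normc_ge0.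
Qed.

Lemma test_dil (l : R) phi : is_test phi -> is_test (dilation l phi).
Proof.
rewrite /dilation; case: (eqVneq l 0) => [_ _|l0 [sp kp]]; first exact: test0.
split; first by apply: smooth_dil => //; rewrite invr_eq0.
have kl : compact ((fun x : 'rV[R]_n => l *: x) @` supp phi).
  apply: continuous_compact => //; apply: continuous_subspaceT.
  exact: scaler_continuous.
apply: (compact_supp kl) => x /= nz; exists (l^-1 *: x).
  exact: subset_closure.
by rewrite scalerA mulfV// scale1r.
Qed.

Lemma partials_supp phi s : [set x | partials s phi x != 0] `<=` supp phi.
Proof.
elim: s => [|j s IH] x /=; first by move=> nx; apply: subset_closure.
apply: contraPP => nx; apply/negP; rewrite negbK; apply/eqP.
have nb : \forall y \near x, partials s phi y = 0.
  have : nbhs x (~` supp phi).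
    by apply: open_nbhs_nbhs; split => //; exact: closed_openC (@closed_closure _ _).
  apply: filterS => y ny; apply/eqP; apply: contrapT => /negP h; exact/ny/IH.
have D0 (g : R[i] -> R) : g 0 = 0 ->
    'D_(delta_mx 0 j) (fun y => g (partials s phi y)) x = 0.
  move=> g0; rewrite (@near_eq_derive _ _ _ _ (cst 0)) ?derive_cst//.
  by apply: filterS nb => y ->.
by rewrite /partial !D0.
Qed.

Lemma compact_weight_bounded (K : set 'rV[R]_n) (N : nat) : compact K ->
  exists2 M : R, 0 < M & forall x, K x -> (1 + `|x|) ^+ N <= M.
Proof.
move=> /compact_bounded /ex_strict_bound_gt0 [M M0 hM].
exists ((1 + M) ^+ N) => [|x Kx]; first by rewrite exprn_gt0// addr_gt0.
apply: lerXn2r; rewrite ?nnegrE ?addr_ge0// ?(ltW M0)//.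
by rewrite lerD2l ltW// hM.
Qed.

Lemma compact_fun_bounded (K : set 'rV[R]_n) (g : 'rV[R]_n -> R) :
  compact K -> continuous g ->
  exists2 M : R, 0 < M & forall x, K x -> `|g x| <= M.
Proof.
move=> cK cg; have /compact_bounded /ex_strict_bound_gt0 [M M0 hM] : compact (g @` K).
  by apply: continuous_compact => //; exact: continuous_subspaceT.
by exists M => // x Kx; apply/ltW/hM; exists x.
Qed.

Lemma normc_le_ReIm (z : R[i]) : normc z <= `|Re z| + `|Im z|.
Proof.
case: z => a b /=; apply: (@le_trans _ _ (Num.sqrt ((`|a| + `|b|) ^+ 2))).
  apply: ler_wsqrtr; rewrite sqrrD !real_normK ?num_real//.
  by rewrite addrAC lerDl mulrn_wge0// mulr_ge0.
by rewrite sqrtr_sqr ger0_norm// addr_ge0.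
Qed.

Lemma test_schwartz phi : is_test phi -> is_schwartz phi.
Proof.
move=> [sp kp]; split=> // N s; have [c1 c2 _] := sp s.
have [W W0 hW] := compact_weight_bounded N kp.
have [A A0 hA] := compact_fun_bounded kp c1.
have [B B0 hB] := compact_fun_bounded kp c2.
exists (W * (A + B)) => x.
have [z0|nz] := eqVneq (partials s phi x) 0.
  by rewrite z0 Normc.normc0 mulr0 mulr_ge0// ?ltW// addr_gt0.
have Kx := partials_supp nz.
apply: ler_pM; rewrite ?exprn_ge0 ?addr_ge0 ?normc_ge0//; first exact: hW.
by apply: (le_trans (normc_le_ReIm _)); rewrite lerD ?hA ?hB.
Qed.

End SmoothFunctions.

Section Spaces.
Variables (R : realType) (n : nat).

Definition schwartz_pred : {pred 'rV[R]_n -> R[i]} :=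
  fun phi => `[< is_schwartz phi >].
Definition test_pred : {pred 'rV[R]_n -> R[i]} :=
  fun phi => `[< is_test phi >].

Lemma schwartz_pred_closed : submod_closed schwartz_pred.
Proof.
split=> [|a f g]; first exact/asboolP/schwartz0.
by move=> /asboolP hf /asboolP hg; exact/asboolP/schwartz_lin.
Qed.

Lemma test_pred_closed : submod_closed test_pred.
Proof.
split=> [|a f g]; first exact/asboolP/test0.
by move=> /asboolP hf /asboolP hg; exact/asboolP/test_lin.
Qed.

HB.instance Definition _ :=
  GRing.isSubmodClosed.Build _ _ schwartz_pred schwartz_pred_closed.
HB.instance Definition _ :=
  GRing.isSubmodClosed.Build _ _ test_pred test_pred_closed.

(* S(R^n) *)
Record schwartz_space := Schwartz {
  schwartz_fun :> 'rV[R]_n -> R[i];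
  schwartz_funP : schwartz_fun \in schwartz_pred }.

HB.instance Definition _ := [isSub for schwartz_fun].
HB.instance Definition _ := [Choice of schwartz_space by <:].
HB.instance Definition _ := [SubChoice_isSubLmodule of schwartz_space by <:].

(* D(R^n) *)
Record test_space := Test {
  test_fun :> 'rV[R]_n -> R[i];
  test_funP : test_fun \in test_pred }.

HB.instance Definition _ := [isSub for test_fun].
HB.instance Definition _ := [Choice of test_space by <:].
HB.instance Definition _ := [SubChoice_isSubLmodule of test_space by <:].

End Spaces.

Section Topologies.
Context {R : realType} {n : nat}.
Local Notation S := (schwartz_space R n).
Local Notation D := (test_space R n).

(* The seminorms rho_N(phi) = sup (1 + |x|)^N |partials s phi x|, over all x
   and all s with size s <= N, generate the topology of S(R^n); this is the
   ball of radius e of rho_N. *)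
Definition schwartz_ball (N : nat) (e : R) : set S :=
  [set phi | forall s : seq 'I_n, (size s <= N)%N ->
    forall x, (1 + `|x|) ^+ N * normc (partials s phi x) <= e].

Definition schwartz_open : set_system S := [set U |
  forall phi, U phi -> exists N, exists2 e : R, 0 < e &
    forall psi, schwartz_ball N e psi -> U (phi + psi)].

Lemma schwartz_ball_le N1 N2 (e1 e2 : R) : (N1 <= N2)%N -> e2 <= e1 ->
  schwartz_ball N2 e2 `<=` schwartz_ball N1 e1.
Proof.
move=> N12 e12 phi h s sN x; apply: le_trans e12.
apply: (le_trans _ (h s (leq_trans sN N12) x)).
by rewrite ler_wpM2r ?normc_ge0// ler_weXn2l// lerDl.
Qed.

Lemma schwartz_openT : schwartz_open setT.
Proof. by move=> phi _; exists 0%N, 1. Qed.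

Lemma schwartz_openI : setI_closed schwartz_open.
Proof.
move=> U V oU oV phi [/oU[N1 [e1 e10 h1]] /oV[N2 [e2 e20 h2]]].
exists (maxn N1 N2), (Num.min e1 e2); first by rewrite lt_min e10.
move=> psi b; split; [apply: h1|apply: h2]; apply: schwartz_ball_le b.
- exact: leq_maxl.
- by rewrite ge_min lexx.
- exact: leq_maxr.
- by rewrite ge_min lexx orbT.
Qed.

Lemma schwartz_open_bigU (I : Type) (f : I -> set S) :
  (forall i, schwartz_open (f i)) -> schwartz_open (\bigcup_i f i).
Proof.
move=> of_ phi [i _ /of_[N [e e0 h]]]; exists N, e => // psi b.
by exists i => //; exact: h.
Qed.

HB.instance Definition _ := isOpenTopological.Build S
  schwartz_openT schwartz_openI schwartz_open_bigU.

Lemma schwartz_openE : @open S = schwartz_open.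
Proof. by []. Qed.

(* D(R^n) is the strict inductive limit of the spaces D_K of the test functions
   supported by a compact set K, each with the topology of the seminorms
   sup |partials s phi x|: a base of neighborhoods of 0 is given by the
   absolutely convex sets whose traces on all D_K are neighborhoods of 0. *)
Definition test_ball (K : set 'rV[R]_n) (N : nat) (e : R) : set D :=
  [set phi | supp phi `<=` K /\ forall s : seq 'I_n, (size s <= N)%N ->
    forall x, normc (partials s phi x) <= e].

Definition absolutely_convex (V : set D) := forall (phi psi : D) (a b : R[i]),
  V phi -> V psi -> `|a| + `|b| <= 1 -> V (a *: phi + b *: psi).

Definition test_nbhs0 (V : set D) := absolutely_convex V /\
  forall K, compact K -> exists N, exists2 e : R, 0 < e & test_ball K N e `<=` V.

Definition test_open : set_system D := [set U |
  forall phi, U phi -> exists2 V, test_nbhs0 V &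
    forall psi, V psi -> U (phi + psi)].

Lemma test_openT : test_open setT.
Proof. by move=> phi _; exists setT => //; split=> // K _; exists 0%N, 1. Qed.

Lemma test_openI : setI_closed test_open.
Proof.
move=> U V oU oV phi [/oU[V1 [c1 n1] h1] /oV[V2 [c2 n2] h2]].
exists (V1 `&` V2); last by move=> psi [b1 b2]; split; [exact: h1|exact: h2].
split=> [p q a b [p1 p2] [q1 q2] ab|K cK].
  by split; [exact: c1|exact: c2].
have [N1 [e1 e10 b1]] := n1 K cK; have [N2 [e2 e20 b2]] := n2 K cK.
exists (maxn N1 N2), (Num.min e1 e2); first by rewrite lt_min e10.
move=> psi [sK b]; split; [apply: b1|apply: b2]; split=> // s sN x.
  have := b s (leq_trans sN (leq_maxl _ _)) x.
  by move/le_trans; apply; rewrite ge_min lexx.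
have := b s (leq_trans sN (leq_maxr _ _)) x.
by move/le_trans; apply; rewrite ge_min lexx orbT.
Qed.

Lemma test_open_bigU (I : Type) (f : I -> set D) :
  (forall i, test_open (f i)) -> test_open (\bigcup_i f i).
Proof.
move=> of_ phi [i _ /of_[V nV h]]; exists V => // psi b.
by exists i => //; exact: h.
Qed.

HB.instance Definition _ := isOpenTopological.Build D
  test_openT test_openI test_open_bigU.

Lemma test_openE : @open D = test_open.
Proof. by []. Qed.

Definition test_to_schwartz (phi : D) : S :=
  Schwartz (asboolT (test_schwartz (asboolW (test_funP phi)))).

Lemma test_to_schwartz_linear : linear test_to_schwartz.
Proof. by move=> a phi psi; exact: val_inj. Qed.

HB.instance Definition _ :=
  GRing.isLinear.Build R[i] D S _ test_to_schwartz test_to_schwartz_linear.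

Lemma schwartz_ball_convex (N : nat) (e : R) (phi psi : S) (a b : R[i]) :
  0 <= e -> schwartz_ball N e phi -> schwartz_ball N e psi ->
  `|a| + `|b| <= 1 -> schwartz_ball N e (a *: phi + b *: psi).
Proof.
move=> e0 hp hq ab s sN x.
have [sp _] := asboolW (schwartz_funP phi).
have [sq _] := asboolW (schwartz_funP psi).
have sbq : smooth (b *: (psi : 'rV[R]_n -> R[i])).
  by have := smooth_lin b sq smooth0; rewrite addr0.
have -> : partials s (a *: phi + b *: psi : S) x =
    a * partials s phi x + b * partials s psi x.
  have := partials_lin b sq smooth0 s; rewrite partials0 !addr0 => eb.
  by have := partials_lin a sp sbq s; rewrite eb => ->.
have w0 : 0 <= (1 + `|x|) ^+ N by rewrite exprn_ge0// addr_ge0.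
apply: (le_trans (ler_wpM2l w0 (normc_comb _ _ _ _))).
rewrite mulrDr !(mulrCA _ (normc _)).
have {}ab : normc a + normc b <= 1.
  by case: a b {sbq} ab => a1 a2 [b1 b2]; rewrite !normc_def -rmorphD /= lecR.
have := ler_wpM2l (normc_ge0 a) (hp s sN x).
have := ler_wpM2l (normc_ge0 b) (hq s sN x).
have := ler_wpM2r e0 ab; lra.
Qed.

Lemma test_to_schwartz_continuous : continuous test_to_schwartz.
Proof.
apply/continuousP => U; rewrite schwartz_openE test_openE => oU phi Uphi.
have [N [e e0 hU]] := oU _ Uphi.
exists (test_to_schwartz @^-1` schwartz_ball N e); last first.
  by move=> psi b; rewrite /preimage /= linearD; exact: hU.
split=> [p q a b hp hq ab|K cK].
  rewrite /preimage /= linearD !linearZ.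
  by apply: schwartz_ball_convex => //; exact: ltW.
have [M M0 hM] := compact_weight_bounded N cK.
exists N, (e / M); first by rewrite divr_gt0.
move=> psi [sK b] s sN x; rewrite /=.
have [->|nz] := eqVneq (partials s psi x) 0.
  by rewrite Normc.normc0 mulr0 ltW.
rewrite -[leRHS](@mulfVK _ M) ?gt_eqF// [leRHS]mulrC.
have Kx := sK _ (partials_supp nz).
apply: ler_pM; rewrite ?exprn_ge0 ?addr_ge0 ?normc_ge0//; first exact: hM.
exact: b.
Qed.

Definition schwartz_dilation (l : R) (phi : S) : S :=
  Schwartz (asboolT (schwartz_dil l (asboolW (schwartz_funP phi)))).

Definition test_dilation (l : R) (phi : D) : D :=
  Test (asboolT (test_dil l (asboolW (test_funP phi)))).

End Topologies.

Section Distributions.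
Context {R : realType} (n : nat) (E : completeNormedModType R[i]).

Record continuous_linear (T : preTopologicalLmodType R[i]) := ContinuousLinear {
  clfun :> {linear T -> E};
  clfunP : continuous clfun }.

(* S'(R^n, E) and D'(R^n, E) *)
Definition tempered_distribution := continuous_linear (schwartz_space R n).
Definition vector_distribution := continuous_linear (test_space R n).

Lemma restriction_continuous (f : tempered_distribution) :
  continuous (f \o test_to_schwartz : {linear test_space R n -> E}).
Proof.
exact: (continuous_compose test_to_schwartz_continuous (@clfunP _ f)).
Qed.

(* The element of D'(R^n, E) defined by an element of S'(R^n, E). *)
Definition restriction (f : tempered_distribution) : vector_distribution :=
  ContinuousLinear (@restriction_continuous f).

(* The norm of a normed module over R[i] is an element of R[i] with zero
   imaginary part. *)
Definition rnorm (v : E) : R := Re `|v|.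

(* [dil l phi] is phi(./l), so that this is < f(l t), phi(t) >. *)
Definition dilated_pairing (T : Type) (dil : R -> T -> T) (f : T -> E)
    (l : R) (phi : T) : E :=
  (l ^- n)%:C *: f (dil l phi).

Definition quasi_bounded (T : Type) (dil : R -> T -> T) (f : T -> E)
    (alpha : R) (L : R -> R) (F : set_system R) :=
  forall phi : T, (limf_esup (fun l : R =>
    ((l `^ alpha * L l)^-1 * rnorm (dilated_pairing dil f l phi))%:E) F
    < +oo)%E.

End Distributions.

Definition quasi_bounded_D {R : realType} {n : nat}
    {E : completeNormedModType R[i]} (f : vector_distribution n E) :=
  quasi_bounded n test_dilation f.

Definition quasi_bounded_S {R : realType} {n : nat}
    {E : completeNormedModType R[i]} (f : tempered_distribution n E) :=
  quasi_bounded n schwartz_dilation f.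

(* The library's [measurable_fun] on R is Borel measurability. *)
Definition lebesgue_measurable_fun {R : realType} (D : set R) (f : R -> R) :=
  forall B : set R, measurable B ->
    completed_algebra_gen (@lebesgue_measure R) (D `&` f @^-1` B).

Definition slowly_varying_origin {R : realType} (L : R -> R) :=
  exists A : R, [/\ 0 < A, lebesgue_measurable_fun `]0, A[ L,
    forall x, 0 < x < A -> 0 < L x &
    forall a, 0 < a -> L (a * l) / L l @[l --> 0^'+] --> (1 : R)].

Definition slowly_varying_infinity {R : realType} (L : R -> R) :=
  exists A : R, [/\ lebesgue_measurable_fun `]A, +oo[ L,
    forall x, A < x -> 0 < L x &
    forall a, 0 < a -> L (a * l) / L l @[l --> +oo] --> (1 : R)].

(* Main.v *)
(* Cut a Schwartz function phi into dyadic pieces phi = chi phi +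
   sum_j theta(2^-j x) phi(x), with theta supported in an annulus. Then
     < f(l t), theta(2^-j t) phi(t) > = 2^(jn) < f(2^j l t), psi_j(t) >,
   where psi_j = theta phi(2^j .) is supported in the ball of radius 4 and
   tends to 0 in C^N faster than any power of 2^-j. The Banach-Steinhaus
   theorem on the space of test functions supported in that ball (proved by a
   gliding hump) turns quasiasymptotic boundedness in D' into
     |< f(m t), psi(t) >| <= C m^alpha L(m) |psi|_N
   for every m close to the origin (resp. infinity), and
   L(2^j l) <= 2^j L(l), since L(2l)/L(l) tends to 1; the series over j is then
   dominated by a geometric one.
   At infinity m = 2^j l stays in the range of this bound. At the origin it
   does not, and for m away from 0 the bound is replaced by the polynomial
   one given by the continuity of f on S; this is absorbed by
   m^alpha L(m) because L(l) >= c l near 0, which is where the measurability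
   of L is used, through a Steinhaus-type argument. *)

Require Import Defs.
From HB Require Import structures.
From mathcomp Require Import all_boot all_order all_algebra.
From mathcomp Require Import complex.
From mathcomp Require Import all_classical all_reals all_analysis.
From mathcomp Require Import measurable_realfun ring lra.

Set Implicit Arguments.
Unset Strict Implicit.
Unset Printing Implicit Defensive.

Import Order.TTheory GRing.Theory Num.Theory.
Import numFieldNormedType.Exports.

Local Open Scope classical_set_scope.
Local Open Scope ring_scope.

Local Notation Re := (@complex.Re _).
Local Notation Im := (@complex.Im _).
Local Notation normc := Normc.normc.

(** * A flat function *)

(** Quasiasymptotic boundedness in D' gives each test function its own bound on its own neighborhood
    of the limit point, whereas the dyadic sum needs one bound for all scales and all functions. The
    uniform boundedness argument is phrased for seminorms [p l] indexed by the scale and a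
    decreasing base of neighborhoods [U k], which serves the origin and infinity alike. Completeness
    enters it only through the limit of one sequence of humps, and test functions are handled as
    elements of S vanishing off a ball, so that [f] applies to them directly. The radius 4 is that
    of theta(x) = chi(x/2) - chi(x), where chi is 1 on the unit ball of the sup norm and 0 off the
    ball of radius 2. At the origin, once 2^j l is no longer small, only the smallness of l remains
    to be compared with l^alpha L(l); hence the need to know that l^alpha L(l) dominates some power
    of l. *)

Section FlatFunction.
Context {R : realType}.
Implicit Types (t x : R) (m : nat).

(** The two difference quotients coincide as functions of the increment. This imports the
    one-variable chain rule and mean value theorem for directional derivatives, without any
    differentiability on [V]. *)
Lemma is_derive_line (V : normedModType R) (w : V -> R) (x v : V) (dw t : R) :
  is_derive (t *: v + x) v w dw <->
  is_derive t (1 : R) (fun h => w (h *: v + x)) dw.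
Proof.
suff e :
    (fun h => h^-1 *: ((w \o shift (t *: v + x)) (h *: v) - w (t *: v + x))) =
    (fun h => h^-1 *: (((fun h => w (h *: v + x)) \o shift t) (h *: 1) -
      w (t *: v + x))).
  by split=> -[h1 h2]; split; move: h1 h2; rewrite /derivable /derive ?e// -?e.
by apply/funext => h /=; rewrite [_%:A]mulr1 scalerDl addrA.
Qed.

Lemma is_derive_comp1 (V : normedModType R) (u : V -> R) (g : R -> R)
    (x v : V) (du dg : R) :
  is_derive x v u du -> is_derive (u x) 1 g dg ->
  is_derive x v (g \o u) (dg * du).
Proof.
have e : x = (0 : R) *: v + x by rewrite scale0r add0r.
by rewrite e => /is_derive_line hu hg; apply/is_derive_line;
  exact: (is_derive1_comp hg hu).
Qed.

(** This is exp(-1/t) / t^m extended by 0. The index [m] is there because the derivative of a member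
    of the family is a combination of two other members. *)
Definition flat m t : R := if 0 < t then t^-1 ^+ m * expR (- t^-1) else 0.

Lemma flat_gt0 m t : 0 < t -> 0 < flat m t.
Proof.
by move=> t0; rewrite /flat t0 mulr_gt0 ?expR_gt0// exprn_gt0//
  invr_gt0.
Qed.

Lemma flat_eq0 m t : t <= 0 -> flat m t = 0.
Proof. by move=> t0; rewrite /flat ltNge t0. Qed.

Lemma flat_ge0 m t : 0 <= flat m t.
Proof. by case: (ltP 0 t) => [/(flat_gt0 m)/ltW//|/(flat_eq0 m) ->]. Qed.

Lemma flat0_homo t x : t <= x -> flat 0 t <= flat 0 x.
Proof.
move=> tx; case: (ltP 0 t) => [t0|/(flat_eq0 0) ->]; last exact: flat_ge0.
have x0 := lt_le_trans t0 tx.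
by rewrite /flat t0 x0 expr0 !mul1r ler_expR lerN2 lef_pV2.
Qed.

(** Comes from exp(1/t) >= (1/t)^(m+2) / (m+2)!. A quadratic bound is what makes the difference
    quotient at 0 tend to 0. *)
Lemma flat_le_sqr m t : `|flat m t| <= m.+2`!%:R * t ^+ 2.
Proof.
rewrite ger0_norm ?flat_ge0//.
case: (ltP 0 t) => [t0|/(flat_eq0 m) ->]; last by rewrite mulr_ge0// sqr_ge0.
rewrite /flat t0 expRN ler_pdivrMr ?expR_gt0//.
have f0 : 0 < m.+2`!%:R :> R by rewrite ltr0n fact_gt0.
have := @expR_ge1Dxn R t^-1 m.+1; rewrite invr_ge0 ltW// => /(_ isT) h.
have {}h : t^-1 ^+ m.+2 <= expR t^-1 * m.+2`!%:R.
  by rewrite -ler_pdivrMr//; apply: le_trans h; rewrite lerDr.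
have -> : t^-1 ^+ m = t ^+ 2 * t^-1 ^+ m.+2.
  by rewrite (exprS _ m.+1) (exprS _ m) expr2 !mulrA -(mulrA t) mulfV ?gt_eqF//
    mulr1 mulfV ?gt_eqF// mul1r.
by rewrite [leRHS]mulrAC [leRHS]mulrC ler_wpM2l ?sqr_ge0// mulrC.
Qed.

Lemma is_derive_flat m t :
  is_derive t 1 (flat m) (flat m.+2 t - m%:R * flat m.+1 t).
Proof.
have [t0|t0|<-] := ltgtP 0 t.
- have e : \forall y \near t,
  ((fun y => y^-1) ^+ m * (expR \o (fun y => - y^-1))) y = flat m y.
    near=> y; rewrite /flat ifT ?fctE ?exprfctE//; near: y; exact: lt_nbhsr.
  apply: (near_eq_is_derive e).
  have iV : is_derive t 1 (fun y : R => y^-1) (- t^-1 ^+ 2).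
    have := is_deriveV (lt0r_neq0 t0) (is_derive_id t 1).
    by rewrite /GRing.scale/= mulr1 exprVn.
  have iE := is_derive_comp1 (is_deriveN iV) (is_derive_expR _).
  apply: is_derive_eq (is_deriveM (is_deriveX m iV) iE) _.
  rewrite /flat t0 !fctE ?exprfctE /GRing.scale/=.
  case: m {e} => [|m]; rewrite ?mul0r ?expr0 ?exprS /= -?[m.+1.-1]/m; ring.
- have e : \forall y \near t, cst 0 y = flat m y.
    near=> y; rewrite flat_eq0// ltW//; near: y; exact: lt_nbhsl.
  by apply: (near_eq_is_derive e); rewrite !flat_eq0 ?ltW// mulr0 subr0;
    exact: is_derive_cst.
- rewrite !flat_eq0// mulr0 subr0.
  have c0 : (fun h => h^-1 *: ((flat m \o shift 0) (h *: 1) - flat m 0)) @ 0^'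
    --> (0 : R).
    apply/cvgr0Pnorm_lt => e e0; near=> h.
    rewrite /= addr0 [_%:A]mulr1 (flat_eq0 _ (lexx 0)) subr0 normrM normfV.
    have h0 : h != 0 by near: h; exact: nbhs_dnbhs_neq.
    rewrite mulrC ltr_pdivrMr ?normr_gt0//.
    apply: (le_lt_trans (flat_le_sqr _ _)).
    rewrite -real_normK ?num_real// expr2 mulrA ltr_pM2r ?normr_gt0//.
    rewrite mulrC -ltr_pdivlMr ?ltr0n ?fact_gt0//.
    near: h; apply: dnbhs0_lt; rewrite divr_gt0// ltr0n fact_gt0//.
  apply: DeriveDef; first by apply/cvg_ex; exists 0.
  exact: cvg_lim c0.
Unshelve. all: by end_near. Qed.

End FlatFunction.

(** * Calculus of smooth functions *)

Section SmoothFunctions.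
Context {R : realType} {n : nat}.
Implicit Types (phi psi a b : 'rV[R]_n -> R[i]) (u v : 'rV[R]_n -> R).
Local Notation e_ j := (delta_mx 0 j : 'rV[R]_n).

(** A class of real functions stable under partial derivatives and rich enough to contain the
    cutoff; stability replaces formulas for higher derivatives of compositions. *)
Inductive elementary : ('rV[R]_n -> R) -> Prop :=
| elementary_cst c : elementary (cst c)
| elementary_coord i : elementary (fun x => x 0 i)
| elementaryD u v : elementary u -> elementary v -> elementary (u + v)
| elementaryM u v : elementary u -> elementary v -> elementary (u * v)
| elementary_flat m u : elementary u -> elementary (flat m \o u).

Lemma elementaryB u v : elementary u -> elementary v -> elementary (u - v).
Proof.
move=> hu hv; have -> : u - v = u + cst (-1) * v.
  by apply/funext => x; rewrite !fctE mulN1r.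
by apply: elementaryD => //; apply: elementaryM => //; exact: elementary_cst.
Qed.

Lemma elementary_sum (I : Type) (r : seq I) (F : I -> 'rV[R]_n -> R) :
  (forall i, elementary (F i)) -> elementary (\sum_(i <- r) F i).
Proof.
move=> h; elim/big_ind : _ => [|u v|i _]; last exact: h.
  exact: (elementary_cst 0).
exact: elementaryD.
Qed.

Lemma elementary_derivable u : elementary u -> continuous u /\
  forall j, exists2 v, elementary v & forall x, is_derive x (e_ j) u (v x).
Proof.
elim=> {u} [c|i|u v hu [cu du] hv [cv dv]|u v hu [cu du] hv [cv dv]|m u hu [cu
  du]].
- split; first exact: cst_continuous.
  by move=> j; exists (cst 0); [exact: elementary_cst|move=> x;
    exact: is_derive_cst].
- split; first exact: coord_continuous.
  move=> j; exists (cst (e_ j 0 i)); first exact: elementary_cst.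
  move=> x; have e : (fun h => h^-1 *: (((fun x : 'rV[R]_n =>
    x 0 i) \o shift x) (h *: e_ j) -
      x 0 i)) @ 0^' --> (e_ j 0 i : R).
    apply: cvg_near_cst; near=> h.
    have h0 : h != 0 by near: h; exact: nbhs_dnbhs_neq.
    by rewrite /= mxE addrK mxE /GRing.scale/= mulKf.
  by split; [apply/cvg_ex; eexists; exact: e|exact: cvg_lim e].
- split; first by move=> x; exact: (cvgD (cu x) (cv x)).
  move=> j; have [u' eu' du'] := du j; have [v' ev' dv'] := dv j.
  by exists (u' + v'); [exact: elementaryD|move=> x; exact: is_deriveD].
- split; first by move=> x; exact: (cvgM (cu x) (cv x)).
  move=> j; have [u' eu' du'] := du j; have [v' ev' dv'] := dv j.
  exists (u * v' + v * u'); first by apply: elementaryD; exact: elementaryM.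
  by move=> x; exact: is_deriveM.
- split.
    move=> x; apply: continuous_comp; first exact: cu.
    apply/differentiable_continuous/derivable1_diffP.
    exact: (@ex_derive _ _ _ _ _ _ _ (is_derive_flat m (u x))).
  move=> j; have [u' eu' du'] := du j.
  exists ((flat m.+2 \o u - cst m%:R * (flat m.+1 \o u)) * u').
    apply: elementaryM => //; apply: elementaryB; first exact: elementary_flat.
    by apply: elementaryM; [exact: elementary_cst|exact: elementary_flat].
  by move=> x; exact: (is_derive_comp1 (du' x) (is_derive_flat m (u x))).
Unshelve. all: by end_near. Qed.

(** The clause of [smooth] for the empty sequence of directions. Continuity of the derivatives is
    the same clause for the next sequences. *)
Definition C1 phi :=
  [/\ continuous (fun x => Re (phi x)), continuous (fun x => Im (phi x)) &
      forall (j : 'I_n) (x : 'rV[R]_n),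
        derivable (fun y => Re (phi y)) x (e_ j) /\
        derivable (fun y => Im (phi y)) x (e_ j)].

(* [partials] applies the derivatives from the inside out, so smoothness is
   obtained from any class of C1 functions that is stable under [partial]. *)
Lemma smooth_coind (P : ('rV[R]_n -> R[i]) -> Prop) :
  (forall phi, P phi -> C1 phi) ->
  (forall phi j, P phi -> P (partial j phi)) ->
  forall phi, P phi -> smooth phi.
Proof.
move=> PC PD phi Pphi s; apply: PC.
by elim: s => [//|j s IH] /=; exact: PD.
Qed.

Lemma smooth_C1 phi : smooth phi -> C1 phi.
Proof. by move/(_ [::]). Qed.

Lemma partials_rcons phi s j :
  partials (rcons s j) phi = partials s (partial j phi).
Proof. by rewrite /partials -cats1 foldr_cat. Qed.

Lemma smooth_partial phi j : smooth phi -> smooth (partial j phi).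
Proof. by move=> sp s; have := sp (rcons s j); rewrite partials_rcons. Qed.

Lemma smooth_elementary u : elementary u -> smooth (fun x => (u x)%:C%C).
Proof.
move=> eu; apply: (@smooth_coind (fun phi => exists2 v,
  elementary v & phi = (fun x => (v x)%:C%C))).
- move=> _ [v /elementary_derivable[cv dv] ->]; split => //=.
    exact: (@cst_continuous _ _ (0 : R)).
  move=> j x; split; last exact: (@derivable_cst _ _ _ (0 : R)).
  by have [w _ dw] := dv j; exact: (@ex_derive _ _ _ _ _ _ _ (dw x)).
- move=> _ j [v /elementary_derivable[_ dv] ->].
  have [w ew dw] := dv j; exists w => //; apply/funext => x.
  rewrite /partial /= (@derive_val _ _ _ _ _ _ _ (dw x)).
  by rewrite (_ : (fun=> 0) = cst 0)// derive_cst.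
- by exists u.
Qed.

Lemma C1_is_derive phi j x : C1 phi ->
  is_derive x (e_ j) (fun y => Re (phi y)) (Re (partial j phi x)) /\
  is_derive x (e_ j) (fun y => Im (phi y)) (Im (partial j phi x)).
Proof. by move=> [_ _ /(_ j x)[/derivableP ? /derivableP]]. Qed.

Lemma ReM (z w : R[i]) : Re (z * w) = Re z * Re w - Im z * Im w.
Proof. by case: z w => ? ? []. Qed.

Lemma ImM (z w : R[i]) : Im (z * w) = Re z * Im w + Im z * Re w.
Proof. by case: z w => ? ? []. Qed.

Lemma ReD (z w : R[i]) : Re (z + w) = Re z + Re w.
Proof. by case: z w => ? ? []. Qed.

Lemma ImD (z w : R[i]) : Im (z + w) = Im z + Im w.
Proof. by case: z w => ? ? []. Qed.

Lemma C1_of_is_derive phi (dphi : 'I_n -> 'rV[R]_n -> R[i]) :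
  continuous (fun x => Re (phi x)) -> continuous (fun x => Im (phi x)) ->
  (forall j x, is_derive x (e_ j) (fun y => Re (phi y)) (Re (dphi j x)) /\
    is_derive x (e_ j) (fun y => Im (phi y)) (Im (dphi j x))) ->
  C1 phi /\ forall j, partial j phi = dphi j.
Proof.
move=> c1 c2 d; split.
  split=> // j x; have [d1 d2] := d j x.
  by split; [exact: (@ex_derive _ _ _ _ _ _ _ d1)|exact: (@ex_derive _ _ _ _ _
    _ _ d2)].
move=> j; apply/funext => x; have [d1 d2] := d j x.
rewrite /partial (@derive_val _ _ _ _ _ _ _ d1) (@derive_val _ _ _ _ _ _ _ d2).
by case: (dphi j x).
Qed.

Lemma C1D a b : C1 a -> C1 b ->
  C1 (a + b) /\ forall j, partial j (a + b) = partial j a + partial j b.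
Proof.
move=> ca cb.
have eR : (fun x => Re ((a + b) x)) = (fun x => Re (a x)) + (fun x => Re (b x)).
  by apply/funext => x; rewrite !fctE ReD.
have eI : (fun x => Im ((a + b) x)) = (fun x => Im (a x)) + (fun x => Im (b x)).
  by apply/funext => x; rewrite !fctE ImD.
have [ca1 ca2 _] := ca; have [cb1 cb2 _] := cb.
apply: C1_of_is_derive; rewrite ?eR ?eI.
- by move=> x; exact: (cvgD (ca1 x) (cb1 x)).
- by move=> x; exact: (cvgD (ca2 x) (cb2 x)).
move=> j x; have [a1 a2] := C1_is_derive j x ca.
have [b1 b2] := C1_is_derive j x cb; rewrite !fctE ReD ImD; split;
  exact: is_deriveD.
Qed.

Lemma C1M a b : C1 a -> C1 b ->
  C1 (a * b) /\ forall j, partial j (a * b) = partial j a * b + a * partial j b.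
Proof.
move=> ca cb.
have eR : (fun x => Re ((a * b) x)) =
    (fun x => Re (a x)) * (fun x => Re (b x)) - (fun x => Im (a x)) * (fun x =>
      Im (b x)).
  by apply/funext => x; rewrite !fctE ReM.
have eI : (fun x => Im ((a * b) x)) =
    (fun x => Re (a x)) * (fun x => Im (b x)) + (fun x => Im (a x)) * (fun x =>
      Re (b x)).
  by apply/funext => x; rewrite !fctE ImM.
have [ca1 ca2 _] := ca; have [cb1 cb2 _] := cb.
apply: C1_of_is_derive; rewrite ?eR ?eI.
- by move=> x; exact: (cvgB (cvgM (ca1 x) (cb1 x)) (cvgM (ca2 x) (cb2 x))).
- by move=> x; exact: (cvgD (cvgM (ca1 x) (cb2 x)) (cvgM (ca2 x) (cb1 x))).
move=> j x; have [a1 a2] := C1_is_derive j x ca.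
have [b1 b2] := C1_is_derive j x cb.
rewrite !fctE ReD ImD !ReM !ImM; split.
  apply: is_derive_eq (is_deriveB (is_deriveM a1 b1) (is_deriveM a2 b2)) _.
  rewrite /GRing.scale/=; ring.
apply: is_derive_eq (is_deriveD (is_deriveM a1 b2) (is_deriveM a2 b1)) _.
rewrite /GRing.scale/=; ring.
Qed.

(** The derivative of a product is a sum of two products, so the products must be closed under sums
    to form a class stable under [partial]. *)
Inductive sum_of_products : ('rV[R]_n -> R[i]) -> Prop :=
| sum_of_products1 a b : smooth a -> smooth b -> sum_of_products (a * b)
| sum_of_productsD a b :
    sum_of_products a -> sum_of_products b -> sum_of_products (a + b).

Lemma smoothM a b : smooth a -> smooth b -> smooth (a * b).
Proof.
move=> sa sb; apply: (@smooth_coind sum_of_products);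
  last exact: sum_of_products1.
  move=> phi; elim=> {phi} [p q /smooth_C1 hp /smooth_C1 hq|p q _ hp _ hq].
    by have [] := C1M hp hq.
  by have [] := C1D hp hq.
suff h phi : sum_of_products phi ->
    C1 phi /\ forall j, sum_of_products (partial j phi).
  by move=> phi j /h [].
elim=> [p q sp sq|p q _ [hp hp'] _ [hq hq']].
  have [cpq d] := C1M (smooth_C1 sp) (smooth_C1 sq); split=> // j; rewrite d.
  have sp' := smooth_partial j sp; have sq' := smooth_partial j sq.
  exact: sum_of_productsD (sum_of_products1 sp' sq) (sum_of_products1 sp sq').
have [cpq d] := C1D hp hq; split=> // j; rewrite d.
exact: sum_of_productsD.
Qed.

Lemma partialsD a b s : smooth a -> smooth b ->
  partials s (a + b) = partials s a + partials s b.
Proof. by move=> sa sb; rewrite -{1}[a]scale1r partials_lin// scale1r. Qed.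

Lemma smoothB a b : smooth a -> smooth b -> smooth (a - b).
Proof. by move=> sa sb; rewrite -scaleN1r addrC; exact: smooth_lin. Qed.

Lemma partialsB a b s : smooth a -> smooth b ->
  partials s (a - b) = partials s a - partials s b.
Proof.
by move=> sa sb;
  rewrite -scaleN1r addrC partials_lin// scaleN1r addrC.
Qed.

(** The bound is pointwise in [x], so that it can carry decay at infinity and be combined with
    vanishing near a point. *)
Definition partials_le (k : nat) phi x (M : R) :=
  forall s : seq 'I_n, (size s <= k)%N -> Normc.normc (partials s phi x) <= M.

Lemma partials_le_ge0 k phi x M : partials_le k phi x M -> 0 <= M.
Proof. by move=> /(_ [::] isT); apply: le_trans; exact: normc_ge0. Qed.

Lemma partials_leW k phi x M : partials_le k.+1 phi x M ->
  partials_le k phi x M.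
Proof. by move=> h s sk; apply: h; exact: leqW. Qed.

Lemma partials_le_partial k phi x M j :
  partials_le k.+1 phi x M -> partials_le k (partial j phi) x M.
Proof.
by move=> h s sk; rewrite -partials_rcons; apply: h;
  rewrite size_rcons.
Qed.

Lemma partials_leD k a b x A B : smooth a -> smooth b ->
  partials_le k a x A -> partials_le k b x B -> partials_le k (a + b) x (A + B).
Proof.
move=> sa sb ha hb s sk; rewrite partialsD//.
by apply: (le_trans (le_normcD _ _)); apply: lerD; [exact: ha|exact: hb].
Qed.

(** Each derivative doubles the number of terms in the Leibniz rule, whence 2^k. The induction peels
    off the innermost derivative, the one that acts on the product itself. *)
Lemma partials_leM k a b x A B : smooth a -> smooth b ->
  partials_le k a x A -> partials_le k b x B ->
  partials_le k (a * b) x (2 ^+ k * (A * B)).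
Proof.
elim: k a b => [|k IH] a b sa sb ha hb s.
  rewrite leqn0 size_eq0 => /eqP ->; rewrite expr0 mul1r /= fctE Normc.normcM.
  by apply: ler_pM; rewrite ?normc_ge0//; [exact: (ha [::])|exact: (hb [::])].
have A0 := partials_le_ge0 ha; have B0 := partials_le_ge0 hb.
case/lastP: s => [_|s j].
  rewrite /= fctE Normc.normcM.
  apply: (@le_trans _ _ (A * B)).
    by apply: ler_pM; rewrite ?normc_ge0//; [exact: (ha [::])|exact: (hb [::])].
  by rewrite ler_peMl ?mulr_ge0// exprn_ege1// ler1n.
rewrite size_rcons ltnS => sk.
have [_ d] := C1M (smooth_C1 sa) (smooth_C1 sb).
rewrite partials_rcons d exprS -mulrA mulr_natl mulr2n.
have sa' := smooth_partial j sa; have sb' := smooth_partial j sb.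
have h1 := IH _ _ sa' sb (partials_le_partial j ha) (partials_leW hb).
have h2 := IH _ _ sa sb' (partials_leW ha) (partials_le_partial j hb).
exact: partials_leD (smoothM sa' sb) (smoothM sa sb') h1 h2 s sk.
Qed.

Lemma partials_near0 phi (x : 'rV[R]_n) : (\forall y \near x, phi y = 0) ->
  forall s, \forall y \near x, partials s phi y = 0.
Proof.
move=> h; elim=> [//|j s IH].
have := nbhs_interior IH; apply: filterS => y hy /=.
have D0 (g : R[i] -> R) : g 0 = 0 ->
  'D_(e_ j) (fun y => g (partials s phi y)) y = 0.
  move=> g0; rewrite (@near_eq_derive _ _ _ _ (cst 0)) ?derive_cst//.
  by apply: filterS hy => z ->.
by rewrite /partial !D0.
Qed.

End SmoothFunctions.

(** * Cutoff functions for the sup norm *)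

Section Cutoff.
Context {R : realType} {n : nat}.
Implicit Types x : 'rV[R]_n.

(* [cutoff_excess] vanishes on the unit ball of the sup norm and is at least
   [flat 0 1] off the ball of radius 2. *)
Definition cutoff_excess : 'rV[R]_n -> R := \sum_(i < n)
  ((flat 0 \o (fun x => x 0 i - 1)) + (flat 0 \o (fun x => - x 0 i - 1))).

(** With c = [flat 0 1], the function t |-> flat(c - t) / flat(c) is 1 at t = 0 and 0 for t >= c; it
    is applied to the excess. *)
Definition cutoff_fun : 'rV[R]_n -> R :=
  cst (flat 0 (flat 0 1))^-1 * (flat 0 \o (cst (flat 0 1) - cutoff_excess)).

Definition cutoff x : R[i] := (cutoff_fun x)%:C%C.

Lemma cutoff_smooth : smooth cutoff.
Proof.
apply: smooth_elementary; apply: elementaryM; first exact: elementary_cst.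
apply: elementary_flat; apply: elementaryB; first exact: elementary_cst.
apply: elementary_sum => i; have e1 := @elementary_cst R n 1.
apply: elementaryD; apply: elementary_flat.
  by have := elementaryB (elementary_coord i) e1; congr elementary;
    apply/funext.
have := elementaryB (elementaryB (elementary_cst 0) (elementary_coord i)) e1.
by congr elementary; apply/funext => x; rewrite !fctE sub0r.
Qed.

Lemma row_norm_ge x i : `|x 0 i| <= `|x|.
Proof.
rewrite [leRHS]mx_normE;
  exact: (le_bigmax _ (fun i : 'I_1 * 'I_n => `|x i.1 i.2|%:nng) (0, i)).
Qed.

Lemma row_norm_gt x r : 0 <= r -> r < `|x| -> exists i, r < `|x 0 i|.
Proof.
move=> r0 rx; have : mx_norm x != 0 by rewrite gt_eqF// (le_lt_trans r0).
move=> /mx_norm_neq0[[i j] /= e]; exists j; move: rx.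
by rewrite /Num.norm/= e (ord1 i).
Qed.

Lemma cutoff1 x : `|x| <= 1 -> cutoff x = 1.
Proof.
move=> x1; rewrite /cutoff /cutoff_fun !fctE /cutoff_excess fct_sumE big1
  ?subr0.
  by rewrite mulVf// gt_eqF// flat_gt0// flat_gt0.
move=> i _; have := le_trans (row_norm_ge x i) x1;
  rewrite ler_norml => /andP[h1 h2].
by rewrite !fctE !flat_eq0 ?addr0//; lra.
Qed.

Lemma cutoff0 x : 2 < `|x| -> cutoff x = 0.
Proof.
move=> /(row_norm_gt (ler0n _ 2))[i xi].
suff h : flat 0 1 <= cutoff_excess x.
  by rewrite /cutoff /cutoff_fun !fctE [X in _ * X]flat_eq0 ?subr_le0// mulr0.
have t0 k : 0 <= ((flat 0 \o (fun x => x 0 k - 1)) + (flat 0 \o (fun x =>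
  - x 0 k - 1))) x.
  by rewrite !fctE addr_ge0// flat_ge0.
rewrite /cutoff_excess fct_sumE (bigD1 i)//=.
apply: (@le_trans _ _ (((flat 0 \o (fun x => x 0 i - 1)) +
    (flat 0 \o (fun x => - x 0 i - 1))) x)); last by rewrite lerDl sumr_ge0.
move: xi; rewrite lter_normr !fctE => /orP[xi|xi].
  by rewrite -[leLHS]addr0 lerD ?flat_ge0// flat0_homo//; lra.
by rewrite -[leLHS]add0r lerD ?flat_ge0// flat0_homo//; lra.
Qed.

End Cutoff.

(** * Limits of smooth functions *)

Section DirectionalMeanValue.
Context {R : realType} {V : normedModType R}.
Implicit Types (x y v : V) (w dw : V -> R) (M h : R).

Lemma directional_mean_value w dw v M : (forall y, is_derive y v w (dw y)) ->
  (forall y, `|dw y| <= M) -> forall x h, `|w (h *: v + x) - w x| <= M * `|h|.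
Proof.
move=> hw hM; have pos x h : 0 <= h -> `|w (h *: v + x) - w x| <= M * `|h|.
  move=> h0; have dl t := (is_derive_line _ _ _ _ _).1 (hw (t *: v + x)).
  have cl : {within `[0, h], continuous (fun t => w (t *: v + x))}.
    apply: continuous_subspaceT => t;
      apply/differentiable_continuous/derivable1_diffP.
    exact: (@ex_derive _ _ _ _ _ _ _ (dl t)).
  have [c _] := MVT_segment h0 (fun t _ => dl t) cl.
  by rewrite scale0r add0r subr0 => ->; rewrite normrM ler_wpM2r.
move=> x h; case: (leP 0 h) => [|h0]; first exact: pos.
(* For negative [h] the segment is run from its other end. *)
have := pos (h *: v + x) (- h); rewrite oppr_ge0 ltW// => /(_ isT).
by rewrite addrA -scalerDl addNr scale0r add0r normrN distrC.
Qed.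

End DirectionalMeanValue.

Section UniformLimits.
Context {R : realType}.
Variable e : nat -> R.
Hypothesis e0 : forall k, 0 <= e k.
Hypothesis e2 : forall k, 2 * e k.+1 <= e k.

Lemma halving_small N (eps : R) : 0 < eps -> exists2 k, (N <= k)%N & e k < eps.
Proof.
move=> eps0; have h k : e k * 2 ^+ k <= e 0.
  elim: k => [|k IH]; first by rewrite mulr1.
  by apply: le_trans IH; rewrite exprS mulrA ler_wpM2r ?exprn_ge0// mulrC.
have [m me] : exists m : nat, e 0 / eps < m%:R.
  by exists (Num.bound (e 0 / eps)); apply: archi_boundP;
    rewrite divr_ge0// ltW.
exists (maxn N m); first exact: leq_maxl.
rewrite -(@ltr_pM2r _ (2 ^+ maxn N m)) ?exprn_gt0//.
apply: (le_lt_trans (h _)); rewrite mulrC -ltr_pdivrMr//.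
apply: (lt_le_trans me); rewrite -natrX ler_nat.
apply: (leq_trans (leq_maxr N m)); exact/ltnW/ltn_expl.
Qed.

(** Since e(k+1) <= e(k) / 2, the numbers a(k) - 2 e(k) increase and a(k) + 2 e(k) decrease from [N]
    on; the limit is the supremum of the lower ones. *)
Lemma halving_limit (a : nat -> R) N :
  (forall k, (N <= k)%N -> `|a k.+1 - a k| <= e k) ->
  exists l, forall k, (N <= k)%N -> `|l - a k| <= 2 * e k.
Proof.
move=> ha.
have lo k d : (N <= k)%N -> a k - 2 * e k <= a (k + d)%N - 2 * e (k + d)%N.
  move=> Nk; elim: d => [|d IH]; first by rewrite addn0.
  apply: (le_trans IH); rewrite addnS.
  have := ha _ (leq_trans Nk (leq_addr d k)); have := e2 (k + d)%N.
  by rewrite ler_norml => h /andP[h1 h2]; lra.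
have hi k d : (N <= k)%N -> a (k + d)%N + 2 * e (k + d)%N <= a k + 2 * e k.
  move=> Nk; elim: d => [|d IH]; first by rewrite addn0.
  apply: le_trans IH; rewrite addnS.
  have := ha _ (leq_trans Nk (leq_addr d k)); have := e2 (k + d)%N.
  by rewrite ler_norml => h /andP[h1 h2]; lra.
have lohi j k : (N <= j)%N -> (N <= k)%N -> a j - 2 * e j <= a k + 2 * e k.
  move=> Nj Nk; apply: (le_trans (lo j k Nj)); apply: le_trans (hi k j Nk).
  by rewrite addnC; have := e0 (k + j)%N; lra.
pose A := [set a k - 2 * e k | k in [set k | (N <= k)%N]].
have supA : has_sup A.
  split; first by exists (a N - 2 * e N), N => /=.
  by exists (a N + 2 * e N) => _ [k /= Nk <-]; exact: lohi.
exists (sup A) => k Nk; rewrite ler_distl; apply/andP; split.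
  by apply: (ub_le_sup supA.2); exists k.
by apply: ge_sup supA.1 _ => _ [j /= Nj <-]; exact: lohi.
Qed.

Lemma halving_limit_continuous (T : topologicalType) (u : T -> R)
    (U : nat -> T -> R) N :
  (forall k, (N <= k)%N -> continuous (U k)) ->
  (forall k x, (N <= k)%N -> `|u x - U k x| <= 2 * e k) -> continuous u.
Proof.
move=> cU hU x; apply/cvgrPdist_lt => eps eps0.
have [k Nk ek] := @halving_small N (eps / 8) (divr_gt0 eps0 (ltr0n _ 8)).
have := cU k Nk x => /cvgrPdist_lt/(_ (eps / 4) (divr_gt0 eps0 (ltr0n _ 4))).
apply: filterS => y; have := hU k x Nk; have := hU k y Nk.
rewrite !ler_distl !ltr_distl => /andP[? ?] /andP[? ?] /andP[? ?].
by apply/andP; split; lra.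
Qed.

(** The mean value inequality for U(m) - U(k), with m sent to infinity, bounds the increments of u -
    U(k) by 4 e(k) |h|. The difference quotients of [u] and U(k) are thus close uniformly in [h],
    which allows the exchange of limits. *)
Lemma halving_limit_derive (V : normedModType R) (v : V) (u du : V -> R)
    (U dU : nat -> V -> R) N :
  (forall k y, (N <= k)%N -> is_derive y v (U k) (dU k y)) ->
  (forall k x, (N <= k)%N -> `|u x - U k x| <= 2 * e k) ->
  (forall k x, (N <= k)%N -> `|du x - dU k x| <= 2 * e k) ->
  forall x, is_derive x v u (du x).
Proof.
move=> dUk hu hdu x.
have emono k d : e (k + d)%N <= e k.
  elim: d => [|d IH]; first by rewrite addn0.
  by apply: le_trans IH; rewrite addnS; have := e2 (k + d)%N;
    have := e0 (k + d).+1; lra.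
have mv k h : (N <= k)%N ->
    `|(u (h *: v + x) - u x) - (U k (h *: v + x) - U k x)| <= 4 * e k * `|h|.
  move=> Nk; apply/ler_addgt0Pl => eps eps0.
  have [m km em] := @halving_small k (eps / 8) (divr_gt0 eps0 (ltr0n _ 8)).
  have Nm := leq_trans Nk km.
  have d y : is_derive y v (U m - U k) (dU m y - dU k y).
    by apply: is_deriveB; exact: dUk.
  have bd y : `|dU m y - dU k y| <= 4 * e k.
    have := hdu m y Nm; have := hdu k y Nk; have := emono k (m - k)%N.
    rewrite subnKC// !ler_distl => ? /andP[? ?] /andP[? ?].
    by apply/andP; split; lra.
  have := directional_mean_value d bd x h; rewrite !fctE.
  move: (4 * e k * `|h|) => c.
  have := hu m x Nm; have := hu m (h *: v + x) Nm.
  rewrite !ler_distl => /andP[? ?] /andP[? ?] /andP[? ?].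
  by apply/andP; split; lra.
have cv : (fun h => h^-1 *: ((u \o shift x) (h *: v) - u x)) @ 0^' --> du x.
  apply/cvgrPdist_lt => eps eps0.
  have [k Nk ek] := @halving_small N (eps / 16) (divr_gt0 eps0 (ltr0n _ 16)).
  have [hk vk] := dUk k x Nk.
  have := hk; rewrite /derivable => /cvgP.
  have : (fun h => h^-1 *: ((U k \o shift x) (h *: v) - U k x)) @ 0^' --> dU k
    x.
    by rewrite -vk.
  move=> /cvgrPdist_lt/(_ (eps / 4) (divr_gt0 eps0 (ltr0n _ 4))) + _.
  move=> hq; near=> h.
  have h0 : h != 0 by near: h; exact: nbhs_dnbhs_neq.
  have : `|dU k x - h^-1 *: ((U k \o shift x) (h *: v) - U k x)| < eps / 4.
    by near: h.
  have := ler_wpM2l (normr_ge0 h^-1) (mv k h Nk).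
  rewrite -normrM mulrBr mulrCA -normrM mulVf// normr1 mulr1.
  rewrite /GRing.scale/=.
  move: (h^-1 * _) (h^-1 * _) => a b; have := hdu k x Nk.
  rewrite !ler_distl !ltr_distl => /andP[? ?] /andP[? ?] /andP[? ?].
  by apply/andP; split; lra.
by split; [apply/cvg_ex; eexists; exact: cv|exact: cvg_lim cv].
Unshelve. all: by end_near. Qed.

End UniformLimits.

Section SmoothLimits.
Context {R : realType} {n : nat}.
Local Notation e_ j := (delta_mx 0 j : 'rV[R]_n).

Lemma normr_Re_le (z : R[i]) : `|Re z| <= normc z.
Proof.
by case: z => a b /=; rewrite -sqrtr_sqr ler_wsqrtr// lerDl sqr_ge0.
Qed.

Lemma normr_Im_le (z : R[i]) : `|Im z| <= normc z.
Proof.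
by case: z => a b /=; rewrite -sqrtr_sqr ler_wsqrtr// lerDr sqr_ge0.
Qed.

Lemma ReB (z w : R[i]) : Re (z - w) = Re z - Re w.
Proof. by case: z w => ? ? []. Qed.

Lemma ImB (z w : R[i]) : Im (z - w) = Im z - Im w.
Proof. by case: z w => ? ? []. Qed.

Variable e : nat -> R.
Hypothesis e0 : forall k, 0 <= e k.
Hypothesis e2 : forall k, 2 * e k.+1 <= e k.

(** Completeness of the space of smooth functions in a form suited to humps: stage [k] controls the
    orders up to [k] only, so the derivative along [s] converges from the index [size s] on. The
    constant 4 adds 2 for the real and 2 for the imaginary part. *)
Lemma smooth_limit (X : nat -> 'rV[R]_n -> R[i]) : (forall k, smooth (X k)) ->
  (forall k x, partials_le k (X k.+1 - X k) x (e k)) ->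
  exists2 Y, smooth Y & forall k x, partials_le k (Y - X k) x (4 * e k).
Proof.
move=> sX hX.
have step s x k : (size s <= k)%N ->
    `|Re (partials s (X k.+1) x) - Re (partials s (X k) x)| <= e k /\
    `|Im (partials s (X k.+1) x) - Im (partials s (X k) x)| <= e k.
  move=> sk; have := hX k x s sk; rewrite partialsB// !fctE => h.
  by rewrite -ReB -ImB; split;
    [apply: le_trans (normr_Re_le _) h|apply: le_trans (normr_Im_le _) h].
(* All derivatives are passed to the limit at once, pointwise; that these limits are the derivatives
   of the limit for the empty sequence is shown afterwards. *)
have /choice[G hG] : forall sx : seq 'I_n * 'rV[R]_n, exists z : R[i],
    forall k, (size sx.1 <= k)%N ->
    `|Re z - Re (partials sx.1 (X k) sx.2)| <= 2 * e k /\
    `|Im z - Im (partials sx.1 (X k) sx.2)| <= 2 * e k.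
  move=> [s x].
  have [l hl] := halving_limit e0 e2 (fun k sk => (step s x k sk).1).
  have [m hm] := halving_limit e0 e2 (fun k sk => (step s x k sk).2).
  by exists (l +i* m)%C => k sk; split; [exact: hl|exact: hm].
pose g s x := G (s, x).
have gRe s k x : (size s <= k)%N ->
  `|Re (g s x) - Re (partials s (X k) x)| <= 2 * e k.
  by move=> sk; have [] := hG (s, x) k sk.
have gIm s k x : (size s <= k)%N ->
  `|Im (g s x) - Im (partials s (X k) x)| <= 2 * e k.
  by move=> sk; have [] := hG (s, x) k sk.
have sXC k s : C1 (partials s (X k)) by exact: sX.
have Cg s : C1 (g s) /\ forall j, partial j (g s) = g (j :: s).
  apply: C1_of_is_derive.
  - apply: (halving_limit_continuous e0 e2 (fun k _ => _) (gRe s)).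
    by move=> k _; have [] := sXC k s.
  - apply: (halving_limit_continuous e0 e2 (fun k _ => _) (gIm s)).
    by move=> k _; have [] := sXC k s.
  move=> j x; split.
    apply: (halving_limit_derive e0 e2 _ (fun k x sk =>
      gRe s k x (ltnW sk)) (gRe (j :: s))) => k y _.
    by have [] := C1_is_derive j y (sXC k s).
  apply: (halving_limit_derive e0 e2 _ (fun k x sk =>
    gIm s k x (ltnW sk)) (gIm (j :: s))) => k y _.
  by have [] := C1_is_derive j y (sXC k s).
have pg s : partials s (g [::]) = g s.
  by elim: s => [//|j s IH] /=; rewrite IH; have [_ ->] := Cg s.
have sg : smooth (g [::]).
  by move=> s; rewrite pg; have [] := Cg s.
exists (g [::]) => // k x s sk.
rewrite partialsB// pg !fctE; apply: (le_trans (normc_le_ReIm _)).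
by rewrite ReB ImB; have := gRe s k x sk; have := gIm s k x sk; lra.
Qed.

End SmoothLimits.

(** * Uniform boundedness on test functions with a common support *)

Section UniformBoundedness.
Context {R : realType} {n : nat}.
Local Notation S := (schwartz_space R n).
Implicit Types (phi psi : S) (r : R).

Definition vanishes_off r (phi : 'rV[R]_n -> R[i]) :=
  forall x, r < `|x| -> phi x = 0.

Lemma vanishes_off_test r (phi : 'rV[R]_n -> R[i]) :
  smooth phi -> vanishes_off r phi -> is_test phi.
Proof.
move=> sp vp; split=> //.
have cK : compact [set x : 'rV[R]_n | `|x| <= r].
  apply: bounded_closed_compact; first by exists r; split;
    [exact: num_real|move=> M rM x /= /le_trans; apply; exact: ltW].
  have cn : continuous (fun x : 'rV[R]_n => `|x|) by exact: norm_continuous.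
  by have := closed_comp (fun x _ => cn x) (@closed_le R r).
apply: (compact_supp cK) => x /= nz; rewrite leNgt; apply/negP => /vp px.
by rewrite px eqxx in nz.
Qed.

Lemma vanishes_off_schwartz r (phi : 'rV[R]_n -> R[i]) :
  smooth phi -> vanishes_off r phi ->
  {psi : S | psi = phi :> ('rV[R]_n -> R[i])}.
Proof.
move=> sp vp.
by exists (Schwartz (asboolT (test_schwartz (vanishes_off_test sp vp)))).
Qed.

Lemma schwartzD_fun phi psi :
  schwartz_fun (phi + psi) = (phi : _ -> _) + (psi : _ -> _).
Proof. by []. Qed.

Lemma schwartzB_fun phi psi :
  schwartz_fun (phi - psi) = (phi : _ -> _) - (psi : _ -> _).
Proof. by []. Qed.

Lemma schwartzZ_fun (c : R[i]) phi :
  schwartz_fun (c *: phi) = c *: (phi : _ -> _).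
Proof. by []. Qed.

Lemma schwartz_smooth phi : smooth phi.
Proof. by have [] := asboolW (schwartz_funP phi). Qed.

Lemma partials_leN k (a : 'rV[R]_n -> R[i]) x M :
  smooth a -> partials_le k a x M -> partials_le k (- a) x M.
Proof.
move=> sa ha s sk; have := partialsB s smooth0 sa.
by rewrite partials0 !sub0r => ->; rewrite fctE normcN; exact: ha.
Qed.

Lemma normc_partialsZ (a : 'rV[R]_n -> R[i]) x (c : R) s : 0 <= c ->
  smooth a -> normc (partials s (c%:C%C *: a) x) = c * normc (partials s a x).
Proof.
move=> c0 sa; have := partials_lin c%:C%C sa smooth0 s.
rewrite partials0 !addr0 => ->; rewrite fctE Normc.normcM /= expr0n/= addr0.
by rewrite sqrtr_sqr ger0_norm.
Qed.

Lemma partials_leZ k (a : 'rV[R]_n -> R[i]) x M (c : R) : 0 <= c ->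
  smooth a -> partials_le k a x M -> partials_le k (c%:C%C *: a) x (c * M).
Proof.
by move=> c0 sa ha s sk; rewrite normc_partialsZ// ler_wpM2l//;
  exact: ha.
Qed.

Lemma partials_le_mono k l (a : 'rV[R]_n -> R[i]) x M N :
  (k <= l)%N -> M <= N -> partials_le l a x M -> partials_le k a x N.
Proof.
by move=> kl MN h s sk; apply: le_trans MN; apply: h; exact: leq_trans kl.
Qed.

(** In the application [p l] is the norm of the pairing at scale [l] divided by l^alpha L(l), and
    [U k] is a base of neighborhoods of the limit point. In [p_bound] both the neighborhood and the
    bound depend on [psi]. *)
Variables (p : R -> S -> R) (U : nat -> set R) (r : R) (N0 : nat).
Hypothesis pD : forall l phi psi, p l (phi + psi) <= p l phi + p l psi.
Hypothesis pZ : forall l (c : R) phi, 0 <= c ->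
  p l (c%:C%C *: phi) = c * p l phi.
Hypothesis pN : forall l phi, p l (- phi) = p l phi.
Hypothesis p_cont : forall l, U 0%N l -> exists C, forall psi e,
  vanishes_off r psi -> (forall x, partials_le N0 psi x e) -> p l psi <= C * e.
Hypothesis p_bound : forall psi, vanishes_off r psi ->
  exists k M, forall l, U k l -> p l psi <= M.
Hypothesis U_mono : forall k, U k.+1 `<=` U k.

(** One index serves both as neighborhood and as order of derivatives, since either can be
    increased. *)
Let good k C := forall l psi e, U k l -> 0 < e -> vanishes_off r psi ->
  (forall x, partials_le k psi x e) -> p l psi <= C * e.

Let U_le j k : (j <= k)%N -> U k `<=` U j.
Proof.
move=> /subnKC <-; elim: (k - j)%N => [|d IH]; first by rewrite addn0.
by rewrite addnS; apply: subset_trans IH; exact: U_mono.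
Qed.

(* The gliding hump: [X'] differs little from [X] in the seminorms of order
   [k], yet [p l X'] is large, and [B'] controls the continuity of [p l],
   so that the later humps, which are divided by it, do not spoil [p l X']. *)
Let hump k (X : S) (B : R) : (forall k C, ~ good k C) ->
  vanishes_off r X -> 1 <= B ->
  exists X' : S, exists B' l, [/\ vanishes_off r X', B <= B', U k l,
    (forall x, partials_le k (X' - X : S) x (2 ^- k / B)) & k%:R <= p l X' /\
    forall psi e, 0 <= e -> vanishes_off r psi ->
      (forall x, partials_le N0 psi x e) -> p l psi <= B' * e].
Proof.
move=> bad vX B1; have B0 : 0 < B by apply: lt_le_trans B1.
have [k0 [M hM]] := p_bound vX.
have [m [km k0m]] : exists m, (k <= m)%N /\ (k0 <= m)%N.
  by exists (maxn k k0); rewrite leq_maxl leq_maxr.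
(* With this constant the hump, rescaled to seminorm 2^-k / B, reaches the value k + M, of which at
   most M is lost to [X]. *)
have : ~ good m ((k%:R + M) * (2 ^+ k * B)) by exact: bad.
move=> /existsNP[l /existsNP[psi /existsNP[e]]].
rewrite !not_implyE => -[Ul [e0 [vpsi [hpsi /negP]]]]; rewrite -ltNge => hl.
have [C hC] := p_cont (U_le (leq0n m) Ul).
pose c := 2 ^- k / B / e.
have c0 : 0 <= c by rewrite !divr_ge0// ltW// exprn_gt0.
exists (X + c%:C%C *: psi), (Num.max B C), l; split.
- by move=> x rx; rewrite schwartzD_fun schwartzZ_fun !fctE vX// vpsi// scaler0
  addr0.
- by rewrite le_max lexx.
- exact: U_le Ul.
- move=> x; rewrite addrAC subrr add0r.
  rewrite -(mulfVK (lt0r_neq0 e0) (2 ^- k / B)).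
  apply: partials_leZ => //; first exact: schwartz_smooth.
  exact: partials_le_mono km (lexx _) (hpsi x).
split.
  have : p l (c%:C%C *: psi) <= p l (X + c%:C%C *: psi) + p l X.
    rewrite -(pN l X); apply: le_trans (pD _ _ _).
    by rewrite addrAC subrr add0r.
  rewrite pZ//; have := hM l (U_le k0m Ul) => h1 h2.
  suff : k%:R + M <= c * p l psi by lra.
  have := ler_wpM2l c0 (ltW hl); apply: le_trans; rewrite le_eqVlt; apply/orP;
    left.
  apply/eqP; rewrite /c; field.
  by rewrite !gt_eqF// exprn_gt0.
move=> phi e' e'0 vphi hphi; apply: (le_trans (hC _ _ vphi hphi)).
by rewrite ler_wpM2r// le_max lexx orbT.
Qed.

(** If the conclusion fails, the humps converge to some [Y]. The error left after stage k is at most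
    4 e(k+1), and the continuity constant of [p l] at that stage is the very number that divides
    2^-(k+1) in e(k+1); hence p l Y >= k - 4 for the scale [l] chosen there, against the boundedness
    at [Y]. *)
Lemma uniform_boundedness : exists k C, forall l psi e, U k l -> 0 < e ->
  vanishes_off r psi -> (forall x, partials_le k psi x e) -> p l psi <= C * e.
Proof.
apply: contrapT => nh.
have bad k C : ~ good k C by move=> g; apply: nh; exists k, C.
(* Choice is made over all states so that the recursion is a total function; off the invariant the
   output is arbitrary. *)
have /choice[out hout] : forall st : nat * (S * R), exists o : (S * R) * R,
    vanishes_off r st.2.1 -> 1 <= st.2.2 ->
    [/\ vanishes_off r o.1.1, st.2.2 <= o.1.2, U st.1 o.2,
      (forall x, partials_le st.1 (o.1.1 - st.2.1 : S) x (2 ^- st.1 / st.2.2)) &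
      st.1%:R <= p o.2 o.1.1 /\ forall psi e, 0 <= e -> vanishes_off r psi ->
      (forall x, partials_le N0 psi x e) -> p o.2 psi <= o.1.2 * e].
  move=> [k [X B]] /=; have [vX|] := pselect (vanishes_off r X); last first.
    by move=> h; exists ((X, B), 0).
  have [B1|] := pselect (1 <= B); last by move=> h; exists ((X, B), 0).
  have [X' [B' [l h]]] := hump k bad vX B1.
  by exists ((X', B'), l).
pose fix st k : S * R := if k is k'.+1 then (out (k', st k')).1 else (0, 1).
have inv k : vanishes_off r (st k).1 /\ 1 <= (st k).2.
  elim: k => [|k [v B1]] /=; first by split.
  have [v' BB _ _ _] := hout (k, st k) v B1.
  by split=> //; apply: le_trans BB.
have hst k := hout (k, st k) (inv k).1 (inv k).2.
pose e k : R := 2 ^- k / (st k).2.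
have B0 k : 0 < (st k).2 by apply: lt_le_trans (inv k).2.
have e0 k : 0 <= e k by rewrite divr_ge0 ?invr_ge0 ?exprn_ge0// ltW.
have e2 k : 2 * e k.+1 <= e k.
  rewrite /e exprS invfM !mulrA mulfV ?mul1r ?pnatr_eq0//.
  by rewrite ler_wpM2l ?invr_ge0 ?exprn_ge0// lef_pV2 ?posrE ?B0//;
    have [] := hst k.
have sX k : smooth (st k).1 by exact: schwartz_smooth.
have [Y sY hY] := smooth_limit e0 e2 sX (fun k x =>
  let: And5 _ _ _ h _ := hst k in h x).
have vY : vanishes_off r Y.
  move=> x rx; apply: Normc.eq0_normc; apply/eqP; rewrite eq_le normc_ge0 andbT.
  apply/ler_addgt0Pl => eps eps0; rewrite addr0.
  have [k _ ek] := halving_small e0 e2 0 (divr_gt0 eps0 (ltr0n _ 4)).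
  have := hY k x [::] isT; rewrite /= !fctE (inv k).1// subr0 => h.
  by apply: (le_trans h); lra.
have [YS YE] := vanishes_off_schwartz sY vY.
have [K [M hM]] : exists k M, forall l, U k l -> p l YS <= M.
  by apply: p_bound; rewrite YE.
(* [K] puts the scale in the neighborhood where [Y] is bounded, [N0] makes the error controlled in
   the order needed for continuity, and M + 5 beats the bound M + 4. *)
pose k := maxn (maxn K N0) (Num.bound (`|M| + 5)).
have kM : M + 5 < k%:R.
  apply: (@lt_le_trans _ _ (Num.bound (`|M| + 5))%:R);
    last by rewrite ler_nat leq_maxr.
  apply: le_lt_trans (archi_boundP _); last by rewrite addr_ge0.
  by rewrite lerD2r ler_norm.
have [_ _ Ul _ [hk hB]] := hst k.
have Kk : (K <= k)%N by rewrite /k -maxnA leq_maxl.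
have N0k : (N0 <= k)%N by rewrite /k (leq_trans (leq_maxr K N0))// leq_maxl.
set l := (out (k, st k)).2 in Ul hk hB.
have h1 := hM l (U_le Kk Ul).
have h2 : p l (YS - (st k.+1).1) <= (st k.+1).2 * (4 * e k.+1).
  apply: hB; first by rewrite mulr_ge0.
    by move=> x rx; rewrite schwartzB_fun !fctE (inv k.+1).1// subr0 YE;
      exact: vY.
  move=> x; have := hY k.+1 x; rewrite -YE.
  exact: partials_le_mono (leqW N0k) (lexx _).
have h3 : (st k.+1).2 * (4 * e k.+1) <= 4.
  have -> : (st k.+1).2 * (4 * e k.+1) = 4 * 2 ^- k.+1.
    have := B0 k.+1; rewrite /e; move: (st k.+1).2 (2 ^- k.+1) => b i b0.
    by field; rewrite gt_eqF.
  rewrite ger_pMr//.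
  by rewrite invf_le1 ?exprn_gt0// exprn_ege1// ler1n.
have h4 : p l (st k.+1).1 <= p l YS + p l (YS - (st k.+1).1).
  rewrite -[p l (YS - _)]pN; apply: le_trans (pD _ _ _).
  by rewrite opprB addrC subrK.
by move: hk; rewrite leNgt => /negP; apply; rewrite -/(st k.+1); lra.
Qed.

End UniformBoundedness.

(** * Dyadic decomposition *)

Section DyadicPieces.
Context {R : realType} {n : nat}.
Local Notation S := (schwartz_space R n).
Implicit Types (phi psi : S) (a b : 'rV[R]_n -> R[i]) (x : 'rV[R]_n).

Lemma normc_real (c : R) : 0 <= c -> normc c%:C%C = c.
Proof. by move=> c0; rewrite /= expr0n/= addr0 sqrtr_sqr ger0_norm. Qed.

(** An order i <= k costs c^i; the majorant D >= 1 bounds it by D^k also when c < 1. *)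
Lemma partials_le_dil k a (c D : R) x M : 0 < c -> c <= D -> 1 <= D ->
  smooth a -> partials_le k a (c *: x) M ->
  partials_le k (fun t => a (c *: t)) x (D ^+ k * M).
Proof.
move=> c0 cD D1 sa ha s sk; rewrite partials_dil ?gt_eqF//.
rewrite Normc.normcM normc_real ?exprn_ge0 ?(ltW c0)//.
apply: ler_pM; rewrite ?exprn_ge0 ?normc_ge0 ?(ltW c0)//; last exact: ha.
apply: (@le_trans _ _ (D ^+ size s)); last by rewrite ler_weXn2l.
by rewrite lerXn2r// nnegrE ?(ltW c0)// (le_trans (ltW c0)).
Qed.

Lemma partials_le_near0 k a x : (\forall y \near x, a y = 0) ->
  partials_le k a x 0.
Proof.
by move=> a0 s _; have /nbhs_singleton -> := partials_near0 a0 s;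
  rewrite Normc.normc0.
Qed.

Lemma near_norm_lt x (r : R) : `|x| < r -> \forall y \near x, `|y| < r.
Proof. by move=> xr; exact: cvgr_lt (@norm_continuous _ _ x) _ xr. Qed.

Lemma near_norm_gt x (r : R) : r < `|x| -> \forall y \near x, r < `|y|.
Proof. by move=> xr; exact: cvgr_gt (@norm_continuous _ _ x) _ xr. Qed.

(** [is_schwartz] has one constant for each sequence of directions; the induction sums the constants
    of the [n] first derivatives to get one for all sequences of length at most [N]. *)
Lemma schwartz_decay a (N Q : nat) : is_schwartz a -> exists2 M : R, 0 < M &
  forall x, partials_le N a x (M / (1 + `|x|) ^+ Q).
Proof.
have w0 x : 0 < (1 + `|x|) ^+ Q by rewrite exprn_gt0// ltr_wpDr.
elim: N a => [|N IH] a [sa da].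
  have [M hM] := da Q [::]; exists (`|M| + 1); first by rewrite ltr_wpDl.
  move=> x s; rewrite leqn0 size_eq0 => /eqP ->.
  rewrite ler_pdivlMr// mulrC; apply: (le_trans (hM x)).
  by rewrite (le_trans (ler_norm M))// lerDl.
have sj j : is_schwartz (partial j a).
  split; first exact: smooth_partial.
  by move=> N' s; have := da N' (rcons s j); rewrite partials_rcons.
have /choice[M hM] : forall j, exists M : R, 0 < M /\
    forall x, partials_le N (partial j a) x (M / (1 + `|x|) ^+ Q).
  by move=> j; have [M M0 h] := IH _ (sj j); exists M.
have [M0 M00 hM0] := IH a (conj sa da).
have S0 : 0 <= \sum_j M j by apply: sumr_ge0 => j _; rewrite ltW//;
  have [] := hM j.
exists (M0 + \sum_j M j); first by rewrite ltr_wpDr.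
move=> x s; case/lastP: s => [_|s j].
  apply: (le_trans (hM0 x [::] isT)).
  by rewrite ler_pM2r ?invr_gt0// lerDl.
rewrite size_rcons ltnS partials_rcons => sN;
  apply: (le_trans ((hM j).2 x s sN)).
rewrite ler_pM2r ?invr_gt0// (bigD1 j)//= addrCA lerDl addr_ge0// ?(ltW M00)//.
by apply: sumr_ge0 => i _; rewrite ltW//; have [] := hM i.
Qed.

Lemma schwartz_bounded a (N : nat) : is_schwartz a -> exists2 M : R, 0 < M &
  forall x, partials_le N a x M.
Proof.
move=> /(schwartz_decay N 0)[M M0 hM]; exists M => // x.
by have := hM x; rewrite expr0 divr1.
Qed.

Lemma schwartzP phi : is_schwartz phi.
Proof. exact: asboolW (schwartz_funP phi). Qed.

Lemma cutoff_dil_vanishes (c : R) : 0 < c ->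
  vanishes_off (2 / c) (fun x : 'rV[R]_n => cutoff (c *: x)).
Proof.
move=> c0 x cx; apply: cutoff0.
by rewrite normrZ gtr0_norm// mulrC -ltr_pdivrMr.
Qed.

Lemma cutoff_dil_smooth (c : R) : 0 < c ->
  smooth (fun x : 'rV[R]_n => cutoff (c *: x)).
Proof.
by move=> c0; apply: smooth_dil;
  [rewrite gt_eqF|exact: cutoff_smooth].
Qed.

Lemma vanishes_offM r a b : vanishes_off r a -> vanishes_off r (a * b).
Proof. by move=> va x rx; rewrite fctE va// mul0r. Qed.

Definition truncated (c : R) a : 'rV[R]_n -> R[i] :=
  (fun x => cutoff (c *: x)) * a.

Lemma truncated_smooth c a : 0 < c -> smooth a -> smooth (truncated c a).
Proof. by move=> c0 sa; exact: smoothM (cutoff_dil_smooth c0) sa. Qed.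

Lemma truncated_vanishes c a : 0 < c -> vanishes_off (2 / c) (truncated c a).
Proof. by move=> c0; apply: vanishes_offM; exact: cutoff_dil_vanishes. Qed.

Lemma cutoff_bounded k : exists2 M : R, 0 < M &
  forall x, partials_le k cutoff x M.
Proof.
apply: schwartz_bounded; apply: test_schwartz.
exact: (vanishes_off_test cutoff_smooth cutoff0).
Qed.

(** The difference vanishes for |x| < 1/c, and elsewhere one extra power of decay provides the
    factor 1 / (1 + |x|) <= c. *)
Lemma truncated_cvg phi N : exists2 M : R, 0 < M &
  forall c psi, 0 < c -> c <= 1 ->
  psi = truncated c phi :> (_ -> _) -> schwartz_ball N (M * c) (phi - psi).
Proof.
have [A A0 hA] := cutoff_bounded N.
have [M M0 hM] := schwartz_decay N N.+1 (schwartzP phi).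
exists (M + 2 ^+ N * (A * M)); first by rewrite ltr_wpDr// !mulr_ge0// ltW.
move=> c psi c0 c1 psiE s sN x; rewrite schwartzB_fun psiE.
have w0 : 0 < 1 + `|x| by rewrite ltr_wpDr.
have sphi : smooth phi by exact: schwartz_smooth.
case: (ltP `|x| c^-1) => xc.
  have nz : \forall y \near x, ((phi : _ -> _) - truncated c phi) y = 0.
    apply: filterS (near_norm_lt xc) => y yc;
      rewrite /truncated !fctE cutoff1 ?mul1r ?subrr//.
    by rewrite normrZ gtr0_norm// mulrC -ler_pdivlMr// div1r ltW.
  rewrite (nbhs_singleton (partials_near0 nz s)) Normc.normc0 mulr0.
  by rewrite mulr_ge0 ?(ltW c0)// addr_ge0 ?(ltW M0)// !mulr_ge0 ?exprn_ge0
    ?(ltW M0) ?(ltW A0).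
have h1 : partials_le N (truncated c phi) x
    (2 ^+ N * (A * (M / (1 + `|x|) ^+ N.+1))).
  apply: (partials_leM (cutoff_dil_smooth c0) sphi _ (hM x)).
  have := partials_le_dil c0 c1 (lexx 1) cutoff_smooth (hA (c *: x)).
  by rewrite expr1n mul1r.
have sN' : smooth (- truncated c phi).
  by rewrite -[- _]add0r; apply: smoothB;
    [exact: smooth0|exact: truncated_smooth].
have h2 := partials_leD sphi sN' (hM x) (partials_leN (truncated_smooth c0
  sphi) h1) sN.
apply: (le_trans (ler_wpM2l (exprn_ge0 N (ltW w0)) h2)).
have -> : (1 + `|x|) ^+ N * (M / (1 + `|x|) ^+ N.+1 +
    2 ^+ N * (A * (M / (1 + `|x|) ^+ N.+1))) =
    (M + 2 ^+ N * (A * M)) * (1 + `|x|)^-1.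
  have wn := lt0r_neq0 w0; have := expf_neq0 N wn; rewrite exprS.
  by move: ((1 + `|x|) ^+ N) => u un; field; rewrite wn un.
rewrite ler_wpM2l ?(addr_ge0, mulr_ge0, exprn_ge0) ?(ltW M0) ?(ltW A0)//.
rewrite invf_ple ?posrE//; apply: (le_trans xc); by rewrite lerDr.
Qed.

Definition annulus_cutoff : 'rV[R]_n -> R[i] :=
  (fun x => cutoff (2^-1 *: x)) - cutoff.

Lemma annulus_cutoff_smooth : smooth annulus_cutoff.
Proof. by apply: smoothB; [exact: cutoff_dil_smooth|exact: cutoff_smooth]. Qed.

Lemma annulus_cutoff_vanishes : vanishes_off 4 annulus_cutoff.
Proof.
move=> x x4; rewrite /annulus_cutoff !fctE [X in X - _]cutoff_dil_vanishes//.
  by rewrite cutoff0 ?subrr// (lt_trans _ x4)// ltr_nat.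
by rewrite invrK; lra.
Qed.

Lemma annulus_cutoff0 x : `|x| <= 1 -> annulus_cutoff x = 0.
Proof.
move=> x1; rewrite /annulus_cutoff !fctE !cutoff1 ?subrr//.
by rewrite normrZ gtr0_norm//; lra.
Qed.

Definition dyadic_piece (j : nat) a : 'rV[R]_n -> R[i] :=
  annulus_cutoff * (fun x => a (2 ^+ j *: x)).

Lemma dyadic_piece_smooth j a : smooth a -> smooth (dyadic_piece j a).
Proof.
move=> sa; apply: smoothM; first exact: annulus_cutoff_smooth.
by apply: smooth_dil; rewrite // gt_eqF// exprn_gt0.
Qed.

Lemma dyadic_piece_vanishes j a : vanishes_off 4 (dyadic_piece j a).
Proof. exact/vanishes_offM/annulus_cutoff_vanishes. Qed.

(** On the annulus 2^j x has norm at least 2^j. Of the N + Q powers of decay of [phi], N pay for the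
    derivatives of the dilation and Q remain. *)
Lemma dyadic_piece_decay phi N Q : exists2 M : R, 0 < M & forall j x,
  partials_le N (dyadic_piece j phi) x (M / 2 ^+ (j * Q)).
Proof.
have [A A0 hA] : exists2 M : R, 0 < M & forall x,
  partials_le N annulus_cutoff x M.
  apply: schwartz_bounded; apply: test_schwartz.
  exact: (vanishes_off_test annulus_cutoff_smooth annulus_cutoff_vanishes).
have [M M0 hM] := schwartz_decay N (N + Q) (schwartzP phi).
exists (2 ^+ N * (A * M)); first by rewrite !mulr_gt0// exprn_gt0.
move=> j x; have j0 : 0 < 2 ^+ j :> R by rewrite exprn_gt0.
have j1 : 1 <= 2 ^+ j :> R by rewrite exprn_ege1// ler1n.
have sphi : smooth phi by exact: schwartz_smooth.
case: (ltP `|x| 1) => x1.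
  apply: (partials_le_mono (leqnn N) _ (partials_le_near0 _)).
    by rewrite divr_ge0 ?exprn_ge0// !mulr_ge0 ?exprn_ge0// ltW.
  by apply: filterS (near_norm_lt x1) => y /ltW y1;
    rewrite /dyadic_piece !fctE annulus_cutoff0// mul0r.
have hphi : partials_le N (fun t => phi (2 ^+ j *: t)) x (M / 2 ^+ (j * Q)).
  have h := partials_le_dil j0 (lexx _) j1 sphi (hM (2 ^+ j *: x)).
  apply: partials_le_mono (leqnn N) _ h.
  rewrite mulrCA ler_pM2l// normrZ gtr0_norm// exprD invfM mulrA.
  have w : 2 ^+ j <= 1 + 2 ^+ j * `|x|.
    by rewrite (le_trans (ler_peMr (ltW j0) x1))// lerDr.
  have w0 := lt_le_trans j0 w.
  rewrite -[leRHS]mul1r; apply: ler_pM.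
  - by rewrite divr_ge0// exprn_ge0// ltW.
  - by rewrite invr_ge0 exprn_ge0// ltW.
  - by rewrite ler_pdivrMr ?exprn_gt0// mul1r lerXn2r// nnegrE ltW.
  rewrite exprM lef_pV2 ?posrE ?exprn_gt0// lerXn2r// nnegrE ltW//.
have := partials_leM annulus_cutoff_smooth _ (hA x) hphi.
by rewrite !mulrA; apply; apply: smooth_dil; rewrite // gt_eqF.
Qed.

Lemma truncated_step j a x :
  truncated (2 ^- j.+1) a x =
  truncated (2 ^- j) a x + dyadic_piece j a (2 ^- j *: x).
Proof.
rewrite /truncated /dyadic_piece /annulus_cutoff !fctE !scalerA -invfM -exprS.
by rewrite mulfV ?expf_neq0 ?pnatr_eq0// scale1r -mulrDl subrKC.
Qed.

End DyadicPieces.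

(** * Pairings with dilated functions *)

Section Pairing.
Context {R : realType} {n : nat} {E : completeNormedModType R[i]}.
Local Notation S := (schwartz_space R n).
Implicit Types (phi psi : S) (l m e : R) (v w : E).

Lemma rnormE v : `|v| = (rnorm v)%:C%C.
Proof.
have := normr_ge0 v; rewrite /rnorm lecE /= => /andP[/eqP h _].
by move: h; case: `|v| => a b /= ->.
Qed.

Lemma rnorm_ge0 v : 0 <= rnorm v.
Proof. by have := normr_ge0 v; rewrite rnormE lecR. Qed.

Lemma rnormD v w : rnorm (v + w) <= rnorm v + rnorm w.
Proof. by have := ler_normD v w; rewrite !rnormE -rmorphD lecR. Qed.

Lemma rnormZ (a : R[i]) v : rnorm (a *: v) = normc a * rnorm v.
Proof.
have : `|a *: v| = `|a| * `|v| by rewrite normrZ.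
by case: a => a b; rewrite normc_def !rnormE -rmorphM => /complexI.
Qed.

Variable f : tempered_distribution n E.

Definition pairing l phi : R :=
  rnorm (dilated_pairing n schwartz_dilation f l phi).

Lemma schwartz_dilationD l phi psi :
  schwartz_dilation l (phi + psi) =
  schwartz_dilation l phi + schwartz_dilation l psi.
Proof.
apply: val_inj; rewrite /= /dilation; case: ifP => // _.
by rewrite [RHS]addr0.
Qed.

Lemma schwartz_dilationZ l (c : R[i]) phi :
  schwartz_dilation l (c *: phi) = c *: schwartz_dilation l phi.
Proof.
apply: val_inj; rewrite /= /dilation; case: ifP => // _.
by rewrite [RHS]scaler0.
Qed.

Lemma schwartz_dilationM l m phi : l != 0 -> m != 0 ->
  schwartz_dilation l (schwartz_dilation m phi) = schwartz_dilation (l * m) phi.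
Proof.
move=> l0 m0; apply: val_inj;
  rewrite /= /dilation mulf_eq0 (negPf l0) (negPf m0)/=.
by apply/funext => x; rewrite scalerA -invfM mulrC.
Qed.

Lemma schwartz_dilationB l phi psi :
  schwartz_dilation l (phi - psi) =
  schwartz_dilation l phi - schwartz_dilation l psi.
Proof. by rewrite -scaleN1r schwartz_dilationD schwartz_dilationZ scaleN1r. Qed.

Lemma pairingD l phi psi :
  pairing l (phi + psi) <= pairing l phi + pairing l psi.
Proof.
rewrite /pairing /dilated_pairing schwartz_dilationD linearD scalerDr.
exact: rnormD.
Qed.

Lemma pairingZ l (c : R) phi : 0 <= c ->
  pairing l (c%:C%C *: phi) = c * pairing l phi.
Proof.
move=> c0; rewrite /pairing /dilated_pairing schwartz_dilationZ linearZ.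
by rewrite scalerA mulrC -scalerA rnormZ normc_real.
Qed.

Lemma pairingN l phi : pairing l (- phi) = pairing l phi.
Proof.
rewrite -scaleN1r /pairing /dilated_pairing schwartz_dilationZ linearZ.
by rewrite scalerA mulrC -scalerA rnormZ normcN Normc.normc1 mul1r.
Qed.

Lemma pairing_dilation l m phi : l != 0 -> 0 < m ->
  pairing l (schwartz_dilation m phi) = m ^+ n * pairing (m * l) phi.
Proof.
move=> l0 m0; have m0' := lt0r_neq0 m0.
rewrite /pairing /dilated_pairing schwartz_dilationM// [l * m]mulrC.
rewrite -[m ^+ n]normc_real ?exprn_ge0 ?(ltW m0)// -rnormZ scalerA -rmorphM.
by rewrite exprMn invfM mulrA mulfV ?expf_neq0// mul1r.
Qed.

Lemma pairingE l phi : 0 < l ->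
  pairing l phi = l ^- n * rnorm (f (schwartz_dilation l phi)).
Proof.
by move=> l0; rewrite /pairing /dilated_pairing rnormZ normc_real// invr_ge0
  exprn_ge0// ltW.
Qed.

Lemma tempered_bound : exists N, exists2 C : R, 0 < C & forall phi e,
  0 < e -> schwartz_ball N e phi -> rnorm (f phi) <= C * e.
Proof.
have : nbhs (0 : S) (f @^-1` ball (0 : E) 1).
  by have := @clfunP _ _ _ f 0; rewrite /continuous_at linear0; apply;
    exact: nbhsx_ballx.
rewrite nbhsE => -[W []]; rewrite schwartz_openE => oW W0 hW.
have [N [d d0 hd]] := oW _ W0.
exists N, d^-1; first by rewrite invr_gt0.
move=> phi e e0 hphi.
have c0 : 0 <= d / e by rewrite divr_ge0// ltW.
have : schwartz_ball N d ((d / e)%:C%C *: phi).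
  move=> s sN x; rewrite schwartzZ_fun normc_partialsZ//;
    last exact: schwartz_smooth.
  rewrite mulrCA; have := ler_wpM2l c0 (hphi s sN x).
  by rewrite mulfVK// gt_eqF.
move=> /hd/hW; rewrite add0r /= linearZ -ball_normE /= sub0r normrN rnormE ltcR
  rnormZ normc_real// => h.
by rewrite ler_pdivlMl//; move: h; rewrite mulrAC ltr_pdivrMr// mul1r => /ltW.
Qed.

(** On the support of the dilated function the weight is at most 1 + r l, and its derivatives cost
    powers of 1/l. The bound serves twice: as continuity at each fixed scale for uniform
    boundedness, and as the polynomial bound away from the origin. *)
Lemma pairing_vanishing (r : R) : 0 <= r ->
  exists N, exists2 C : R, 0 < C & forall l psi e,
  0 < l -> 0 < e -> vanishes_off r psi -> (forall x, partials_le N psi x e) ->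
  pairing l psi <= C * (l ^- n * (1 + r * l) ^+ N * (1 + l^-1) ^+ N) * e.
Proof.
move=> r0; have [N [C C0 hC]] := tempered_bound; exists N, C => //.
move=> l psi e l0 e0 vpsi hpsi; rewrite pairingE//.
have i0 : 0 < l^-1 by rewrite invr_gt0.
have a0 : 0 < 1 + r * l by rewrite ltr_wpDr// mulr_ge0// ltW.
have b0 : 0 < 1 + l^-1 by rewrite ltr_wpDr// ltW.
have : schwartz_ball N ((1 + r * l) ^+ N * ((1 + l^-1) ^+ N * e))
  (schwartz_dilation l psi).
  move=> s sN x; rewrite /= /dilation gt_eqF//.
  case: (ltP (r * l) `|x|) => xr.
    have nz : \forall y \near x, psi (l^-1 *: y) = 0.
      apply: filterS (near_norm_gt xr) => y ry; apply: vpsi.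
      by rewrite normrZ gtr0_norm// mulrC ltr_pdivlMr.
    rewrite (nbhs_singleton (partials_near0 nz s)) Normc.normc0 mulr0.
    by rewrite !mulr_ge0 ?exprn_ge0// ltW.
  apply: ler_pM; rewrite ?exprn_ge0 ?addr_ge0 ?normc_ge0//.
    by apply: lerXn2r; rewrite ?nnegrE ?(ltW a0) ?addr_ge0// lerD2l.
  apply: partials_le_dil (hpsi _) _ sN => //; first by rewrite lerDr.
    by rewrite lerDl ltW.
  exact: schwartz_smooth.
move=> /hC; rewrite !mulr_gt0 ?exprn_gt0// => /(_ isT) h.
have := ler_wpM2l (_ : 0 <= l ^- n) h;
  rewrite invr_ge0 exprn_ge0 ?(ltW l0)// => /(_ isT).
move/le_trans; apply; rewrite le_eqVlt; apply/orP; left; apply/eqP; ring.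
Qed.

Lemma truncated_schwartz c phi : 0 < c ->
  {psi : S | psi = truncated c phi :> (_ -> _)}.
Proof.
move=> c0; have sp : smooth (truncated c phi).
  by apply: truncated_smooth => //; exact: schwartz_smooth.
exact: (vanishes_off_schwartz sp (@truncated_vanishes _ _ c phi c0)).
Qed.

Lemma dyadic_schwartz j phi : {psi : S | psi = dyadic_piece j phi :> (_ -> _)}.
Proof.
have sp : smooth (dyadic_piece j phi).
  by apply: dyadic_piece_smooth; exact: schwartz_smooth.
exact: (vanishes_off_schwartz sp (@dyadic_piece_vanishes _ _ j phi)).
Qed.

Lemma pairing_truncated_cvg l phi (eps : R) : 0 < l -> 0 < eps ->
  exists J : nat, forall psi, psi = truncated (2 ^- J) phi :> (_ -> _) ->
    pairing l (phi - psi) <= eps.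
Proof.
move=> l0 eps0; have [N [C C0 hC]] := tempered_bound.
have [M M0 hM] := truncated_cvg (schwartz_dilation l phi) N.
pose d := C * M * l ^- n / l.
have d0 : 0 < d by rewrite !mulr_gt0// invr_gt0// exprn_gt0.
(* Dilation by [l] turns truncation at 2^-K into truncation at 2^-K / l. The first bound makes this
   at most 1, the second makes the error d 2^-K at most [eps]. *)
pose K := maxn (Num.bound (l^-1)) (Num.bound (d / eps)).
have K2 : K%:R < 2 ^+ K :> R by rewrite -natrX ltr_nat ltn_expl.
have J0 : 0 < 2 ^+ K :> R by rewrite exprn_gt0.
have h1 : 2 ^- K / l <= 1.
  rewrite -invfM invf_le1 ?mulr_gt0// -ler_pdivrMr// div1r ltW//.
  apply: lt_trans K2; apply: (lt_le_trans (archi_boundP _));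
    first by rewrite invr_ge0 ltW.
  by rewrite ler_nat leq_maxl.
have h2 : d * 2 ^- K <= eps.
  rewrite ler_pdivrMr// mulrC -ler_pdivrMr// ltW//.
  apply: lt_trans K2; apply: (lt_le_trans (archi_boundP _));
    first by rewrite divr_ge0// ltW.
  by rewrite ler_nat leq_maxr.
exists K => psi psiE; rewrite pairingE//.
have c0 : 0 < 2 ^- K / l by rewrite divr_gt0// invr_gt0.
have e : schwartz_dilation l psi = truncated (2 ^- K / l) (schwartz_dilation l
  phi) :> (_ -> _).
  rewrite /= /dilation gt_eqF// psiE; apply/funext => x.
  by rewrite /truncated !fctE scalerA.
have := hM _ _ c0 h1 e; rewrite -schwartz_dilationB => /hC.
rewrite mulr_gt0// => /(_ isT) h.
apply: le_trans h2; rewrite /d.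
have := ler_wpM2l (_ : 0 <= l ^- n) h;
  rewrite invr_ge0 exprn_ge0 ?(ltW l0)// => /(_ isT).
move/le_trans; apply; rewrite le_eqVlt; apply/orP; left; apply/eqP; ring.
Qed.

Lemma pairing_truncated l phi (P : nat -> S) (T : nat -> S) : 0 < l ->
  (forall j, P j = dyadic_piece j phi :> (_ -> _)) ->
  (forall j, T j = truncated (2 ^- j) phi :> (_ -> _)) ->
  forall J, pairing l (T J) <= pairing l (T 0%N) +
    \sum_(j < J) 2 ^+ (j * n) * pairing (2 ^+ j * l) (P j).
Proof.
move=> l0 hP hT; elim=> [|J IH]; first by rewrite big_ord0 addr0.
rewrite big_ord_recr/= addrA.
have J0 : 0 < 2 ^+ J :> R by rewrite exprn_gt0.
have -> : T J.+1 = T J + schwartz_dilation (2 ^+ J) (P J).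
  apply: val_inj; apply/funext => x.
  rewrite -[LHS]/(T J.+1 x) hT truncated_step -hT.
  by rewrite -[RHS]/(T J x + dilation (2 ^+ J) (P J) x) /dilation gt_eqF// hP.
apply: (le_trans (pairingD _ _ _)); apply: lerD => //.
by rewrite pairing_dilation ?gt_eqF// exprM.
Qed.

(* The piece of [phi] around |x| = 2 ^ j is, after rescaling, a test function
   supported in a fixed ball, and the factor lost in passing from [l] to
   [2 ^ j * l] is beaten by the decay of [phi]. *)
Lemma dyadic_bound (Lam : set R) (G : R -> R) (N P : nat) (C : R) : 0 <= C ->
  (forall l, Lam l -> [/\ 0 < l, 0 <= G l & forall j psi e, 0 < e ->
     vanishes_off 4 psi -> (forall x, partials_le N psi x e) ->
     pairing (2 ^+ j * l) psi <= C * 2 ^+ (j * P) * G l * e]) ->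
  forall phi, exists K : R, forall l, Lam l -> pairing l phi <= K * G l.
Proof.
move=> C0 hLam phi.
have /choice[T hT] : forall j, exists psi : S,
  psi = truncated (2 ^- j) phi :> (_ -> _).
  move=> j; have j0 : 0 < 2 ^- j :> R by rewrite invr_gt0 exprn_gt0.
  by have [psi] := truncated_schwartz phi j0; exists psi.
have /choice[W hW] : forall j, exists psi : S,
  psi = dyadic_piece j phi :> (_ -> _).
  by move=> j; have [psi] := dyadic_schwartz j phi; exists psi.
(* The rescaling loses 2^(jn) and the hypothesis 2^(jP); one more order leaves the ratio 1/2. *)
have [M M0 hM] := @dyadic_piece_decay _ _ phi N (n + P).+1.
have [B B0 hB] := schwartz_bounded N (schwartzP (T 0%N)).
exists (C * B + 2 * (C * M)) => l /hLam[l0 G0 hl].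
have vT : vanishes_off 4 (T 0%N).
  move=> x x4; rewrite hT truncated_vanishes//.
  by apply: lt_trans x4; rewrite expr0 invrK mulr1 ltr_nat.
have h0 : pairing l (T 0%N) <= C * B * G l.
  have := hl 0%N _ _ B0 vT hB; rewrite ?mul0n !expr0 mul1r mulr1.
  by move/le_trans; apply; rewrite mulrAC.
have hj j : 2 ^+ (j * n) * pairing (2 ^+ j * l) (W j) <= C * M * G l * 2 ^- j.
  have e0 : 0 < M / 2 ^+ (j * (n + P).+1) by rewrite divr_gt0// exprn_gt0.
  have := hl j (W j) _ e0;
    rewrite hW => /(_ (@dyadic_piece_vanishes _ _ _ _) (hM j)) h.
  have jn : 0 <= 2 ^+ (j * n) :> R by rewrite exprn_ge0.
  apply: (le_trans (ler_wpM2l jn h)); rewrite le_eqVlt; apply/orP; left;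
    apply/eqP.
  rewrite mulnS mulnDr !exprD.
  have n1 : 2 ^+ j != 0 :> R by rewrite expf_neq0.
  have n2 : 2 ^+ (j * n) != 0 :> R by rewrite expf_neq0.
  have n3 : 2 ^+ (j * P) != 0 :> R by rewrite expf_neq0.
  by move: (2 ^+ j) (2 ^+ (j * n)) (2 ^+ (j * P)) n1 n2 n3 => u v w n1 n2 n3;
    field; rewrite n1 n2 n3.
have geo J : \sum_(j < J) 2 ^- j <= 2 - 2 * 2 ^- J :> R.
  elim: J => [|J IH]; first by rewrite big_ord0 expr0 invr1; lra.
  rewrite big_ord_recr /=; have : 2 * 2 ^- J.+1 = 2 ^- J :> R.
    by rewrite exprS invfM mulrA mulfV// mul1r.
  by lra.
(* The number of pieces depends on [l] and [eps], but the bound on their sum does not. *)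
apply/ler_addgt0Pl => eps eps0.
have [J /(_ _ (hT J)) hJ] := pairing_truncated_cvg phi l0 eps0.
have := pairing_truncated l0 hW hT J.
have : \sum_(j < J) 2 ^+ (j * n) * pairing (2 ^+ j * l) (W j) <= C * M * G l *
  2.
  apply: (@le_trans _ _ (C * M * G l * \sum_(j < J) 2 ^- j)).
    by rewrite mulr_sumr; apply: ler_sum => j _; exact: hj.
  rewrite ler_wpM2l ?mulr_ge0 ?(ltW M0)//; apply: (le_trans (geo J)).
  by rewrite gerBl mulr_ge0// invr_ge0 exprn_ge0.
have := pairingD l (phi - T J) (T J); rewrite subrK.
lra.
Qed.

End Pairing.

(** * Slowly varying functions *)

Section LebesgueScaling.
Context {R : realType}.
Local Notation mu := (@lebesgue_measure R).
Local Open Scope ereal_scope.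

Lemma measurable_scale (c : R) : measurable_fun setT (fun v : R => (c * v)%R).
Proof. by apply: measurable_funM => //; exact: measurable_cst. Qed.

(** By uniqueness: [c] times the pushforward under multiplication by [c] agrees with Lebesgue
    measure on half-open intervals. *)
Lemma lebesgue_measure_scale (c : R) (A : set R) : (0 < c)%R -> measurable A ->
  mu ((fun v => c * v)%R @^-1` A) = c^-1%:E * mu A.
Proof.
move=> c0 mA.
have c0' : (0 <= c)%R by exact: ltW.
suff h : mu A = c%:E * mu ( *%R c @^-1` A).
  by rewrite h muleA -EFinM mulVf ?gt_eqF// mul1e.
have ms : @measurable_fun _ _ (measurableTypeR R) (measurableTypeR R) setT (
  *%R c).
  exact: measurable_scale.
refine (@lebesgue_measure_unique R (mscale (NngNum c0')
  (measure_function_pushforward__canonical__measure_function_Measure mu ms)) _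
    A mA).
move=> _ [[a b]] _ <-.
have e : ( *%R c @^-1` `]a, b]%classic = `](a / c)%R,
  (b / c)%R]%classic :> set R).
  by apply/seteqP; split => x /=;
    rewrite !in_itv /= ltr_pdivrMr// ler_pdivlMr//;
    rewrite ![(x * c)%R]mulrC.
have : mu `]a, b]%classic = c%:E * mu ( *%R c @^-1` `]a, b]%classic).
  rewrite e !lebesgue_measure_itv/= !lte_fin ltr_pM2r ?invr_gt0//.
  case: ifPn => _; last by rewrite mule0.
  by rewrite -!EFinB -EFinM mulrBr ![(c * _)%R]mulrC !divfK// gt_eqF.
exact.
Qed.

End LebesgueScaling.

Section EventuallyLargeSets.
Context {R : realType}.
Local Notation mu := (@lebesgue_measure R).
Local Notation lebesgue_measurable := (completed_algebra_gen mu).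

Lemma measurable_scale_preimage (c : R) (X : set R) :
  measurable X -> measurable ( *%R c @^-1` X).
Proof.
move=> mX; have := @measurable_scale R c measurableT X mX; rewrite setTI.
exact.
Qed.

Lemma lebesgue_measurable_scale (c : R) (X : set R) : 0 < c ->
  lebesgue_measurable X -> lebesgue_measurable ( *%R c @^-1` X).
Proof.
move=> c0 [P mP [N [M [mM M0 NM]] <-]]; rewrite preimage_setU.
exists ( *%R c @^-1` P); first exact: measurable_scale_preimage.
exists ( *%R c @^-1` N) => //; exists ( *%R c @^-1` M); split.
- exact: measurable_scale_preimage.
- by have := lebesgue_measure_scale c0 mM; rewrite M0 mule0.
- by move=> x /NM.
Qed.

(** The sets of points lying in all F(k) with k >= m increase to the whole interval, so continuity
    from below applies. As F(k) is only Lebesgue measurable, it is first replaced by a Borel subset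
    [PM.1] that fills it up to a Borel null set [PM.2]. *)
Lemma eventually_large (a b e : R) (F : nat -> set R) : a < b -> 0 < e ->
  (forall k, lebesgue_measurable (F k)) ->
  (forall v, a <= v <= b -> exists k0, forall k, (k0 <= k)%N -> F k v) ->
  exists k0, forall k, (k0 <= k)%N -> exists P : set R,
    [/\ measurable P, P `<=` F k `&` `[a, b]%classic &
        ((b - a - e)%:E < mu P)%E].
Proof.
move=> ab e0 mF evF.
have /choice[PM hPM] : forall k, exists PM : set R * set R,
    [/\ measurable PM.1, measurable PM.2, mu PM.2 = 0%E, PM.1 `<=` F k &
      F k `<=` PM.1 `|` PM.2].
  move=> k; have [P mP [N [M [mM M0 NM]] <-]] := mF k.
  by exists (P, M); split => //=; exact: setUS.
pose J : set R := `[a, b]%classic.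
have mJ : measurable J by exact: measurable_itv.
pose Q m : set R := J `&` \bigcap_k (PM (m + k)%N).1.
have mQ m : measurable (Q m).
  apply: measurableI => //; apply: bigcapT_measurable => k.
  by have [] := hPM (m + k)%N.
have ndQ : nondecreasing_seq Q.
  move=> m m' mm'; rewrite subsetEset => x [Jx hx]; split => // k _.
  have := hx (m' - m + k)%N I; rewrite addnA subnKC//; exact.
have mUQ : measurable (\bigcup_m Q m) by exact: bigcupT_measurable.
have cvQ := nondecreasing_cvg_mu (mu := mu) mQ mUQ ndQ.
have mUM : measurable (\bigcup_k (PM k).2).
  by apply: bigcupT_measurable => k; have [] := hPM k.
have UM0 : mu (\bigcup_k (PM k).2) = 0%E.
  apply/negligibleP => //; apply: negligible_bigcup => k; apply/negligibleP.
    by have [] := hPM k.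
  by have [] := hPM k.
have JUQ : J `<=` \bigcup_m Q m `|` \bigcup_k (PM k).2.
  move=> v Jv; have [[k Mk]|nM] := pselect (exists k, (PM k).2 v).
    by right; exists k.
  left; have [k0 hk0] := evF v Jv; exists k0 => //; split=> // k _.
  have [_ _ _ _ /(_ v (hk0 _ (leq_addr k k0)))[//|Mv]] := hPM (k0 + k)%N.
  by exfalso; apply: nM; exists (k0 + k)%N.
have muJ : mu J = (b - a)%:E by rewrite lebesgue_measure_itv/= lte_fin ab EFinB.
have big : ((b - a)%:E <= mu (\bigcup_m Q m))%E.
  rewrite -muJ -[leRHS]adde0 -UM0; apply: le_trans (measureU2 _ _ _) => //.
  by apply: le_measure; rewrite ?inE//=; apply: measurableU.
have [m hm] : exists m, ((b - a - e)%:E < mu (Q m))%E.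
  apply: contrapT => nh; have : (mu (\bigcup_m Q m) <= (b - a - e)%:E)%E.
    have <- := cvg_lim _ cvQ; last exact: ereal_hausdorff.
    apply: lime_le; first by apply/cvg_ex; eexists; exact: cvQ.
    near=> m; rewrite leNgt; apply/negP => h; apply: nh; exists m; exact: h.
  by move=> /(le_trans big); rewrite lee_fin; lra.
exists m => k mk; exists (J `&` (PM k).1); have [mP _ _ PF _] := hPM k; split.
- exact: measurableI.
- by move=> x [Jx /PF Fx].
- apply: (lt_le_trans hm); apply: le_measure; rewrite ?inE//=;
  [exact: mQ|exact: measurableI|].
  by move=> x [Jx /(_ (k - m)%N I)]; rewrite subnKC.
Unshelve. all: by end_near. Qed.

End EventuallyLargeSets.

Section SlowVariation.
Context {R : realType}.
Implicit Types (L : R -> R) (l u v d : R).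
Local Notation mu := (@lebesgue_measure R).

Lemma near_right0P (P : set R) :
  (\forall l \near 0^'+, P l) -> exists2 d, 0 < d & forall l, 0 < l < d -> P l.
Proof.
move=> [d /= d0 hd]; exists d => // l /andP[l0 ld]; apply: hd => //=.
by rewrite sub0r normrN gtr0_norm.
Qed.

Lemma ratio_near_one (a b : R) : 0 < b -> `|1 - a / b| < 2^-1 ->
  a <= 2 * b /\ b <= 2 * a.
Proof.
move=> b0; have -> : 1 - a / b = (b - a) / b by field; rewrite gt_eqF.
rewrite normrM normfV (gtr0_norm b0) ltr_pdivrMr// ltr_norml => /andP[h1 h2].
by split; lra.
Qed.

Lemma slowly_varying_origin_ratio L (A : R) : 0 < A ->
  (forall x, 0 < x < A -> 0 < L x) ->
  (forall a, 0 < a -> L (a * l) / L l @[l --> 0^'+] --> (1 : R)) ->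
  forall a, 0 < a -> exists2 d, 0 < d & forall l, 0 < l < d ->
    L (a * l) <= 2 * L l /\ L l <= 2 * L (a * l).
Proof.
move=> A0 Lpos hL a a0; have := hL a a0.
move=> /cvgrPdist_lt/(_ 2^-1) [|d /= d0 hd]; first by rewrite invr_gt0.
exists (Num.min d A); first by rewrite lt_min d0.
move=> l /andP[l0]; rewrite lt_min => /andP[ld lA]; apply: ratio_near_one.
  by apply: Lpos; rewrite l0.
by apply: hd => //=; rewrite sub0r normrN gtr0_norm.
Qed.

Lemma doubling_iter L l (j : nat) :
  (forall i, (i < j)%N -> L (2 * (2 ^+ i * l)) <= 2 * L (2 ^+ i * l)) ->
  L (2 ^+ j * l) <= 2 ^+ j * L l.
Proof.
elim: j => [|j IH] h; first by rewrite expr0 !mul1r.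
rewrite !exprS -!mulrA; apply: (le_trans (h j (ltnSn j))).
by rewrite ler_wpM2l//; apply: IH => i ij; apply: h; exact: ltnW.
Qed.

(* If [L (u_k x_k) > 4 L (x_k)] along some [x_k --> 0] and [u_k] in [1, 2],
   then no [v] has both [L (x_k v) <= 2 L (x_k)] and [L (u_k x_k) <= 2 L (x_k
     v)],
   while each of these two conditions holds on most of [1, 8], resp. of
   [u_k, 4 u_k], for large [k]. *)
Lemma slowly_varying_origin_bounded L : slowly_varying_origin L ->
  exists2 d, 0 < d & forall l u, 0 < l < d -> 1 <= u <= 2 ->
    L (u * l) <= 4 * L l.
Proof.
move=> [A [A0 mL Lpos hL]]; apply: contrapT => nh.
have ratio := slowly_varying_origin_ratio A0 Lpos hL.
(* The 8 keeps x_k v in ]0, A[ for v <= 8, and y_k v for v <= 4 since y_k < 2 r_k. *)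
pose r k : R := A / 8 / k.+1%:R.
have r0 k : 0 < r k by rewrite !divr_gt0.
have rA k : r k <= A / 8.
  by rewrite ler_pdivrMr// ler_peMr ?divr_ge0 ?(ltW A0)// ler1n.
have rsmall d : 0 < d -> exists k0, forall k, (k0 <= k)%N -> r k < d.
  move=> d0; exists (Num.bound (A / 8 / d)) => k k0.
  rewrite /r ltr_pdivrMr// [ltRHS]mulrC -ltr_pdivrMr//.
  apply: (lt_le_trans (archi_boundP _));
    first by rewrite !divr_ge0 ?(ltW A0) ?(ltW d0)//.
  by rewrite ler_nat ltnW.
have /choice[xu hxu] : forall k, exists xu : R * R,
    [/\ 0 < xu.1, xu.1 < r k, 1 <= xu.2,
      xu.2 <= 2 & 4 * L xu.1 < L (xu.2 * xu.1)].
  move=> k; apply: contrapT => nk; apply: nh;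
    exists (r k) => // l u /andP[l0 lr] /andP[u1 u2].
  by rewrite leNgt; apply/negP => h; apply: nk; exists (l, u).
pose D : set R := `]0, A[%classic.
pose F k := *%R (xu k).1 @^-1` (D `&` L @^-1` `]-oo, 2 * L (xu k).1]%classic).
pose y k := (xu k).2 * (xu k).1.
pose G k := *%R (y k) @^-1` (D `&` L @^-1` `[L (y k) / 2, +oo[%classic).
have x0 k : 0 < (xu k).1 by have [] := hxu k.
have y0 k : 0 < y k.
  by rewrite mulr_gt0//; have [_ _ h _ _] := hxu k; apply: lt_le_trans h.
have yr k : y k < 2 * r k.
  have [_ h1 h2 h3 _] := hxu k; rewrite /y.
  by apply: (@le_lt_trans _ _ (2 * (xu k).1)); rewrite ?ler_pM2r// ltr_pM2l.
have mF k : completed_algebra_gen mu (F k).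
  by apply: (lebesgue_measurable_scale (x0 k)); apply: mL.
have mG k : completed_algebra_gen mu (G k).
  by apply: (lebesgue_measurable_scale (y0 k)); apply: mL.
have evF v : 1 <= v <= 8 -> exists k0, forall k, (k0 <= k)%N -> F k v.
  move=> /andP[v1 v8]; have v0 : 0 < v by exact: lt_le_trans v1.
  have [d d0 hd] := ratio v v0; have [k0 hk0] := rsmall d d0.
  exists k0 => k /hk0 rd; have [_ xr _ _ _] := hxu k; split.
    rewrite /D /= in_itv /= mulr_gt0//=.
    apply: (@le_lt_trans _ _ ((xu k).1 * 8)); first by rewrite ler_pM2l.
    by rewrite -ltr_pdivlMr//; apply: lt_le_trans xr (rA k).
  rewrite /= in_itv /= mulrC; apply: (hd _ _).1.
  by rewrite x0 (lt_trans xr).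
have evG v : 1 <= v <= 4 -> exists k0, forall k, (k0 <= k)%N -> G k v.
  move=> /andP[v1 v4]; have v0 : 0 < v by exact: lt_le_trans v1.
  have [d d0 hd] := ratio v v0;
    have [k0 hk0] := rsmall (d / 2) (divr_gt0 d0 (ltr0n _ 2)).
  exists k0 => k /hk0 rd; have yk := yr k; split.
    rewrite /D /= in_itv /= mulr_gt0//=.
    apply: (@le_lt_trans _ _ (y k * 4)); first by rewrite ler_pM2l.
    by have := rA k; lra.
  rewrite /= in_itv /= andbT ler_pdivrMr// [y k * v]mulrC [leRHS]mulrC;
    apply: (hd _ _).2.
  by rewrite y0/=; lra.
have h8 : (1 : R) < 8 by rewrite ltr1n.
have h4 : (1 : R) < 4 by rewrite ltr1n.
have [kF hF] := eventually_large h8 (@ltr01 R) mF evF.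
have [kG hG] := eventually_large h4 (@ltr01 R) mG evG.
pose k := maxn kF kG.
have [P [mP PF muP]] := hF k (leq_maxl _ _).
have [Q [mQ QG muQ]] := hG k (leq_maxr _ _).
have [_ _ u1 u2 hk] := hxu k; set u := (xu k).2 in u1 u2 hk *;
  set x := (xu k).1 in hk *.
have u0 : 0 < u by exact: lt_le_trans u1.
(* As y_k (v / u) = x_k v, this expresses the second condition in the variable of the first. [P] and
   [Q'] are then disjoint subsets of [1, 8] of measures above 6 and 2, too much for the length 7. *)
pose Q' := *%R u^-1 @^-1` Q.
have mQ' : measurable Q' by exact: measurable_scale_preimage.
have muQ' : (2%:E < mu Q')%E.
  have := lebesgue_measure_scale (_ : 0 < u^-1) mQ.
  rewrite invr_gt0 invrK => /(_ u0); rewrite -/Q' => ->.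
  have q2 : (2%:E < mu Q)%E by apply: le_lt_trans muQ; rewrite lee_fin; lra.
  apply: (lt_le_trans q2); rewrite -[leLHS]mul1e; apply: lee_wpmul2r;
    first exact: measure_ge0.
  by rewrite lee_fin.
have PQ' : P `&` Q' = set0.
  rewrite -subset0 => v [/PF[[_ /= hPv] _] /QG[[_ /= hQv] _]].
  move: hPv hQv; rewrite !in_itv /= andbT => hPv.
  have -> : y k * (u^-1 * v) = x * v by rewrite /y -/u -/x; field;
    rewrite gt_eqF.
  by rewrite /y -/u -/x; lra.
have PQ8 : P `|` Q' `<=` `[1, 8]%classic.
  move=> v [/PF[_ //]|/QG[_ /=]]; rewrite !in_itv /= => /andP[h1 h2].
  have e : v = u * (u^-1 * v) by rewrite mulrA mulfV ?gt_eqF// mul1r.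
  move: (u^-1 * v) e h1 h2 => w -> h1 h2; apply/andP; split.
    by rewrite (le_trans u1)// ler_peMr// ltW.
  rewrite (_ : 8 = 2 * 4 :> R); last by rewrite -natrM.
  by apply: ler_pM => //; [exact: ltW|apply: le_trans h1].
have : (mu (P `|` Q') <= 7%:E)%E.
  have <- : mu `[1, 8]%classic = 7%:E.
    by rewrite lebesgue_measure_itv/= lte_fin ltr1n -EFinB; congr EFin; lra.
  by apply: le_measure; rewrite ?inE//=; exact: measurableU.
have := @measureU _ _ _ mu _ _ mP mQ' PQ'; rewrite /= => ->.
apply/negP; rewrite -ltNge.
apply: (@lt_le_trans _ _ (6%:E + 2%:E)%E); first by rewrite -EFinD lte_fin; lra.
apply: leeD; last exact: ltW.
by apply: le_trans (ltW muP); rewrite lee_fin; lra.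
Qed.

(** For a fixed [d3] take 2^j l <= d3 < 2^(j+1) l. Then L(d3) <= 4 L(2^j l) <= 4 2^j L(l) with 2^j
    <= d3 / l. Doubling does not land on [d3] itself, and the bound uniform over ratios in [1, 2]
    covers the last step. *)
Lemma slowly_varying_origin_lower L : slowly_varying_origin L ->
  exists c, exists2 d, 0 < d & 0 < c /\ forall l, 0 < l < d ->
    [/\ c * l <= L l, 0 < L l & L (2 * l) <= 2 * L l].
Proof.
move=> sL; have [d1 d10 h1] := slowly_varying_origin_bounded sL.
have [A [A0 _ Lpos hL]] := sL.
have [d2 d20 h2] := slowly_varying_origin_ratio A0 Lpos hL (ltr0n _ 2).
have [d3 d30 [d31 d32 d3A]] : exists2 d, 0 < d & [/\ d < d1, d < d2 & d < A].
  exists (Num.min d1 (Num.min d2 A) / 2).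
    by rewrite divr_gt0// !lt_min d10 d20.
  have m0 : 0 < Num.min d1 (Num.min d2 A) by rewrite !lt_min d10 d20.
  split.
  - by rewrite ltr_pdivrMr// (@le_lt_trans _ _ d1) ?ge_min ?lexx//; lra.
  - by rewrite ltr_pdivrMr// (@le_lt_trans _ _ d2) ?ge_min ?lexx ?orbT//; lra.
  - by rewrite ltr_pdivrMr// (@le_lt_trans _ _ A) ?ge_min ?lexx ?orbT//; lra.
have L30 : 0 < L d3 by apply: Lpos; rewrite d30.
exists (L d3 / (4 * d3)), d3 => //; split; first by rewrite divr_gt0// mulr_gt0.
move=> l /andP[l0 ld]; have Ll0 : 0 < L l by apply: Lpos;
  rewrite l0 (lt_trans ld).
split=> //; last by apply: (h2 _ _).1; rewrite l0 (lt_trans ld).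
have ex : exists j, d3 < 2 ^+ j.+1 * l.
  exists (Num.bound (d3 / l)); rewrite -ltr_pdivrMr//.
  apply: (lt_le_trans (archi_boundP _)); first by rewrite divr_ge0// ltW.
  by rewrite -natrX ler_nat ltnW// (ltn_trans (ltnSn _))// ltn_expl.
case: (ex_minnP ex) => j hj minj.
have jd : 2 ^+ j * l <= d3.
  case: j hj minj => [|j] hj minj; first by rewrite mul1r ltW.
  by rewrite leNgt; apply/negP => /minj; rewrite ltnn.
have j0 : 0 < 2 ^+ j * l by rewrite mulr_gt0// exprn_gt0.
have hj2l : d3 <= 2 * (2 ^+ j * l) by rewrite mulrA -exprS ltW.
have := h1 (2 ^+ j * l) (d3 / (2 ^+ j * l)).
rewrite j0 (le_lt_trans jd)// ler_pdivlMr// mul1r jd ler_pdivrMr// hj2l.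
move=> /(_ isT isT); rewrite divfK ?gt_eqF// => hd.
have hj2 : L (2 ^+ j * l) <= 2 ^+ j * L l.
  apply: doubling_iter => i ij; apply: (h2 _ _).1.
  rewrite mulr_gt0 ?exprn_gt0//=; apply: le_lt_trans d32; apply: le_trans jd.
  by rewrite ler_pM2r// ler_weXn2l ?ler1n// ltnW.
rewrite mulrAC ler_pdivrMr ?mulr_gt0//.
have h3 : 2 ^+ j * l * L l <= d3 * L l by rewrite ler_pM2r.
have := ler_wpM2r (ltW l0) hd; have := ler_wpM2l (ltW l0) hj2.
lra.
Qed.

End SlowVariation.

(** * Quasiasymptotic boundedness *)

Section Quasiboundedness.
Context {R : realType} {n : nat} {E : completeNormedModType R[i]}.
Local Notation S := (schwartz_space R n).
Implicit Types (phi psi : S) (l e : R).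

Lemma limf_esup_ltyP (g : R -> R) (F : set_system R) :
  (limf_esup (fun l => (g l)%:E) F < +oo)%E <->
  exists2 V, F V & exists M : R, forall l, V l -> g l <= M.
Proof.
rewrite limf_esupE; split.
  move=> /ereal_inf_lt[_ [V FV <-] Vy]; exists V => //.
  exists (fine (ereal_sup [set (g l)%:E | l in V])) => l Vl.
  have : ((g l)%:E <= ereal_sup [set (g l)%:E | l in V])%E.
    by apply: ereal_sup_ubound; exists l.
  by move: Vy; case: ereal_sup.
move=> [V FV [M hM]]; apply: (@le_lt_trans _ _ M%:E); last exact: ltry.
apply: (le_trans (ereal_inf_lbound _)); first by exists V.
by apply: ge_ereal_sup => _ [l Vl <-]; rewrite lee_fin; exact: hM.
Qed.

Variables (f : tempered_distribution n E) (alpha : R) (L : R -> R).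
Variables (F : set_system R) (U : nat -> set R).
Hypothesis FU : forall k, F (U k).
Hypothesis U_base : forall V, F V -> exists k, U k `<=` V.
Hypothesis U_mono : forall k, U k.+1 `<=` U k.
Hypothesis U_pos : forall l, U 0%N l -> 0 < l /\ 0 < L l.

Local Notation gauge l := (l `^ alpha * L l).

Let U0 k : U k `<=` U 0%N.
Proof. by elim: k => [//|k IH]; apply: subset_trans IH; exact: U_mono. Qed.

Let gauge_gt0 k l : U k l -> 0 < gauge l.
Proof. by move=> /U0/U_pos[l0 Ll0]; rewrite mulr_gt0// powR_gt0. Qed.

Lemma quasi_bounded_D_uniform : quasi_bounded_D (restriction f) alpha L F ->
  exists k C, 0 <= C /\ forall l psi e, U k l -> 0 < e -> vanishes_off 4 psi ->
    (forall x, partials_le k psi x e) -> pairing f l psi <= C * gauge l * e.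
Proof.
(* The absolute value makes [p l] a seminorm for every [l], also where the sign of the gauge is
   unknown. *)
move=> qD; pose p l psi := `|(gauge l)^-1| * pairing f l psi.
have pD l phi psi : p l (phi + psi) <= p l phi + p l psi.
  by rewrite /p -mulrDr ler_wpM2l// pairingD.
have pZ l (c : R) phi : 0 <= c -> p l (c%:C%C *: phi) = c * p l phi.
  by move=> c0; rewrite /p pairingZ// mulrCA.
have pN l phi : p l (- phi) = p l phi by rewrite /p pairingN.
have [N [C C0 hC]] := pairing_vanishing f (ler0n R 4).
have p_cont l : U 0%N l -> exists C, forall psi e, vanishes_off 4 psi ->
    (forall x, partials_le N psi x e) -> p l psi <= C * e.
  move=> /U_pos[l0 _]; exists (`|(gauge l)^-1| * (C * (l ^- n * (1 + 4 * l) ^+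
    N * (1 + l^-1) ^+ N))).
  move=> psi e vpsi hpsi; rewrite /p -[leRHS]mulrA ler_wpM2l//.
  set K := C * _; have K0 : 0 <= K.
    have i0 : 0 <= l^-1 by rewrite invr_ge0 ltW.
    rewrite mulr_ge0 ?(ltW C0)// !mulr_ge0 ?exprn_ge0 ?addr_ge0 ?mulr_ge0 ?(ltW
      l0)//.
    by rewrite invr_ge0 exprn_ge0// ltW.
  have e0 := partials_le_ge0 (hpsi 0).
  (* Here [e] may be 0 while [pairing_vanishing] wants it positive, so it is enlarged by d / (K +
     1), which costs at most [d]. *)
  apply/ler_addgt0Pl => d d0.
  have K1 : 0 < K + 1 by rewrite ltr_wpDl.
  have d1 : 0 < d / (K + 1) by rewrite divr_gt0.
  have := hC l psi (e + d / (K + 1)) l0;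
    rewrite -/K ltr_wpDl// => /(_ isT vpsi) h.
  apply: (le_trans (h _)).
    by move=> x; apply: partials_le_mono (leqnn N) _ (hpsi x);
      rewrite lerDl ltW.
  rewrite mulrDr addrC lerD2r mulrCA ger_pMr// ler_pdivrMr// mul1r lerDl//.
have p_bound psi : vanishes_off 4 psi -> exists k M, forall l, U k l ->
  p l psi <= M.
  move=> vpsi; have tpsi := vanishes_off_test (@schwartz_smooth _ _ psi) vpsi.
  have := qD (Test (asboolT tpsi)) => /limf_esup_ltyP[V FV [M hM]].
  have [k0 hk0] := U_base FV.
  exists k0, M => l Ul; have := hM l (hk0 l Ul).
  rewrite /p ger0_norm ?invr_ge0 ?(ltW (gauge_gt0 Ul))//.
  congr (_ * rnorm (_ *: f _) <= _); exact: val_inj.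
have [k [C' hC']] := uniform_boundedness pD pZ pN p_cont p_bound U_mono.
exists k, (Num.max C' 0); split; first by rewrite le_max lexx orbT.
move=> l psi e Ul e0 vpsi hpsi; have := hC' l psi e Ul e0 vpsi hpsi.
have g0 := gauge_gt0 Ul; rewrite /p ger0_norm ?invr_ge0 ?(ltW g0)//.
rewrite ler_pdivrMl// => /le_trans; apply.
rewrite mulrA [_ * C']mulrC ler_pM2r// ler_pM2r// le_max lexx//.
Qed.

Lemma quasi_bounded_S_of_bound :
  (forall phi, exists k K, forall l, U k l -> pairing f l phi <= K * gauge l) ->
  quasi_bounded_S f alpha L F.
Proof.
move=> h phi; apply/limf_esup_ltyP; have [k [K hK]] := h phi.
exists (U k); first exact: FU.
by exists K => l Ul; rewrite ler_pdivrMl ?(gauge_gt0 Ul)// mulrC; exact: hK.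
Qed.

End Quasiboundedness.

Section Gauge.
Context {R : realType}.

Lemma powR_dyadic_le (alpha l : R) (a j : nat) : alpha <= a%:R -> 0 < l ->
  (2 ^+ j * l) `^ alpha <= 2 ^+ (j * a) * l `^ alpha.
Proof.
move=> aa l0; have j0 : 0 <= 2 ^+ j :> R by rewrite exprn_ge0.
rewrite powRM ?(ltW l0)// ler_wpM2r ?powR_ge0// exprM -(powR_mulrn a j0).
by rewrite ler_powR// exprn_ege1// ler1n.
Qed.

Lemma natr_above (alpha : R) : exists a : nat, alpha <= a%:R.
Proof.
exists (Num.bound `|alpha|); apply: (le_trans (ler_norm _)).
exact/ltW/archi_boundP.
Qed.

End Gauge.

(** * The two cases of the theorem *)

Lemma quasi_bounded_infinity (R : realType) (n : nat)
  (E : completeNormedModType R[i]) (alpha : R) (L : R -> R)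
  (f : tempered_distribution n E) : slowly_varying_infinity L ->
  quasi_bounded_D (restriction f) alpha L +oo -> quasi_bounded_S f alpha L +oo.
Proof.
move=> [A [_ Lpos hL]] qD.
have [X X0 hX] : exists2 X : R, 0 <= X & forall l, X < l ->
  0 < L l /\ L (2 * l) <= 2 * L l.
  have := hL 2 (ltr0n _ 2) => /cvgrPdist_lt/(_ 2^-1) [|X [_ hX]];
    first by rewrite invr_gt0.
  exists (Num.max 0 (Num.max A X)) => [|l]; first by rewrite le_max lexx.
  rewrite !gt_max => /and3P[l0 Al Xl]; have Ll := Lpos l Al.
  by split => //; apply: (ratio_near_one Ll _).1; exact: hX.
pose U k := [set l : R | X + k%:R < l].
have FU k : (+oo : set_system R) (U k).
  by exists (X + k%:R); split; [exact: num_real|].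
have U_base V : (+oo : set_system R) V -> exists k, U k `<=` V.
  move=> [M [_ hM]]; exists (Num.bound `|M|) => l Ul; apply: hM.
  apply: (le_lt_trans (ler_norm M));
    apply: (lt_trans (archi_boundP (normr_ge0 M))).
  by apply: le_lt_trans Ul; rewrite lerDr.
have U_mono k : U k.+1 `<=` U k.
  by move=> l; apply: le_lt_trans; rewrite lerD2l ler_nat.
have U_pos l : U 0%N l -> 0 < l /\ 0 < L l.
  rewrite /U /= addr0 => Xl; split; first exact: le_lt_trans Xl.
  by have [] := hX l Xl.
have [k [C [C0 hC]]] := quasi_bounded_D_uniform U_base U_mono U_pos qD.
apply: (quasi_bounded_S_of_bound FU U_mono U_pos) => phi.
have [a ha] := natr_above alpha.
suff [K hK] : exists K : R, forall l, U k l ->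
  pairing f l phi <= K * (l `^ alpha * L l).
  by exists k, K.
(* Passing from [l] to 2^j l costs 2^(ja) for the power and 2^j for [L]. *)
apply: (@dyadic_bound _ _ _ f (U k) (fun l => l `^ alpha * L l) k a.+1 C C0).
move=> l Ul; have Xl : X < l by apply: le_lt_trans Ul; rewrite lerDl.
have l0 : 0 < l by exact: le_lt_trans Xl.
have [Ll _] := hX l Xl.
have step j : l <= 2 ^+ j * l
  by rewrite ler_peMl ?(ltW l0)// exprn_ege1// ler1n.
split=> //; first by rewrite mulr_ge0 ?powR_ge0// ltW.
move=> j psi e e0 vpsi hpsi.
have Uj : U k (2 ^+ j * l) by apply: lt_le_trans Ul (step j).
apply: (le_trans (hC _ _ _ Uj e0 vpsi hpsi)).
rewrite ler_pM2r// -[leRHS]mulrA ler_wpM2l//.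
rewrite (_ : 2 ^+ (j * a.+1) * _ = 2 ^+ (j * a) * l `^ alpha * (2 ^+ j * L l));
  last first.
  by rewrite mulnS exprD; ring.
apply: ler_pM; rewrite ?powR_ge0//.
- by have [/ltW] := hX _ (lt_le_trans Xl (step j)).
- exact: powR_dyadic_le.
by apply: doubling_iter => i _; have [] := hX _ (lt_le_trans Xl (step i)).
Qed.

Lemma quasi_bounded_origin (R : realType) (n : nat)
  (E : completeNormedModType R[i]) (alpha : R) (L : R -> R)
  (f : tempered_distribution n E) : slowly_varying_origin L ->
  quasi_bounded_D (restriction f) alpha L 0^'+ ->
    quasi_bounded_S f alpha L 0^'+.
Proof.
move=> sL qD; have [c [d d0 [c0 hd]]] := slowly_varying_origin_lower sL.
pose U k := [set l : R | 0 < l < d / k.+1%:R].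
have FU k : (0 : R)^'+ (U k).
  near=> l; apply/andP; split; near: l; first exact: nbhs_right_gt.
  by apply: nbhs_right_lt; rewrite divr_gt0.
have U_base V : (0 : R)^'+ V -> exists k, U k `<=` V.
  move=> /near_right0P[r r0 hr]; exists (Num.bound (d / r)) => l /andP[l0 ld].
  apply: hr; rewrite l0 (lt_trans ld)// ltr_pdivrMr// [ltRHS]mulrC
    -ltr_pdivrMr//.
  apply: (lt_le_trans (archi_boundP _)); first by rewrite divr_ge0// ltW.
  by rewrite ler_nat ltnW.
have U_mono k : U k.+1 `<=` U k.
  move=> l /andP[l0 ld]; apply/andP; split=> //; apply: (lt_le_trans ld).
  by rewrite ler_pM2l// lef_pV2 ?posrE// ler_nat.
have U_d k l : U k l -> 0 < l < d.
  move=> /andP[-> ld]; apply: (lt_le_trans ld).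
  by rewrite ler_pdivrMr// ler_peMr ?(ltW d0)// ler1n.
have U_pos l : U 0%N l -> 0 < l /\ 0 < L l.
  by move=> /U_d ld; have [_ Ll _] := hd l ld; case/andP: ld.
have [k [C [C0 hC]]] := quasi_bounded_D_uniform U_base U_mono U_pos qD.
have [N [C2 C20 hC2]] := pairing_vanishing f (ler0n R 4).
apply: (quasi_bounded_S_of_bound FU U_mono U_pos) => phi.
have [a ha] := natr_above alpha.
pose s := d / k.+1%:R; have s0 : 0 < s by rewrite divr_gt0.
(* For l <= 1 larger exponents give smaller powers, so that l^P <= l^(a+1) and l^a <= l^alpha. *)
have [m [km m1]] : exists m, (k <= m)%N /\ forall l, U m l -> l <= 1.
  have [m hm] := U_base _ (nbhs_right_lt (ltr01 : (0 : R) < 1)).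
  exists (maxn k m); split; first exact: leq_maxl.
  move=> l /andP[l0 ld]; apply/ltW/hm/andP; split=> //; apply: (lt_le_trans ld).
  by rewrite ler_pM2l// lef_pV2 ?posrE// ler_nat ltnS leq_maxr.
(* Every negative power of mu = 2^j l is bounded through mu >= s. In [P], N is the growth of the
   polynomial bound, and a + 1 is the power of [l] that l^alpha L(l) dominates. *)
pose C3 := C2 * (s ^- n * (s^-1 + 4) ^+ N * (1 + s^-1) ^+ N) * s ^- a.+1 / c.
pose P := (N + a.+1)%N.
have si0 : 0 < s^-1 by rewrite invr_gt0.
have C30 : 0 <= C3.
  rewrite /C3 !mulr_ge0 ?exprn_ge0 ?addr_ge0 ?(ltW C20) ?(ltW si0)//;
    last by rewrite invr_ge0 ltW.
    by rewrite invr_ge0 exprn_ge0// ltW.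
  by rewrite invr_ge0 exprn_ge0// ltW.
suff [K hK] : exists K : R, forall l, U m l ->
  pairing f l phi <= K * (l `^ alpha * L l).
  by exists m, K.
apply: (@dyadic_bound _ _ _ f (U m) (fun l =>
  l `^ alpha * L l) (maxn k N) P (C + C3)).
  by rewrite addr_ge0.
move=> l Ul; have /andP[l0 ld] := U_d _ _ Ul; have l1 := m1 l Ul.
have [cL Ll _] := hd l (U_d _ _ Ul).
have g0 : 0 <= l `^ alpha * L l by rewrite mulr_ge0 ?powR_ge0// ltW.
split=> // j psi e e0 vpsi hpsi.
have j0 : 0 < 2 ^+ j :> R by rewrite exprn_gt0.
have j1 : 1 <= 2 ^+ j :> R by rewrite exprn_ege1// ler1n.
rewrite !mulrDl; set G := l `^ alpha * L l in g0 *.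
have P0 : 0 <= 2 ^+ (j * P) :> R by rewrite exprn_ge0.
have Ge0 X : 0 <= X -> 0 <= X * 2 ^+ (j * P) * G * e.
  by move=> X0; rewrite mulr_ge0 ?(ltW e0)// mulr_ge0// mulr_ge0.
case: (ltP (2 ^+ j * l) s) => js.
  have Uj : U k (2 ^+ j * l) by rewrite /U /= mulr_gt0.
  have hpsi' x : partials_le k psi x e.
    exact: partials_le_mono (leq_maxl k N) (lexx e) (hpsi x).
  apply: (le_trans (hC _ _ _ Uj e0 vpsi hpsi')).
  apply: (@le_trans _ _ (C * 2 ^+ (j * P) * G * e)); last first.
    by rewrite lerDl; exact: Ge0.
  rewrite ler_pM2r// -[leRHS]mulrA ler_wpM2l//.
  apply: (@le_trans _ _ (2 ^+ (j * a.+1) * G)); last first.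
    by rewrite ler_wpM2r// ler_weXn2l ?ler1n// leq_mul2l leq_addl orbT.
  rewrite (_ : _ * G = 2 ^+ (j * a) * l `^ alpha * (2 ^+ j * L l)); last first.
    by rewrite mulnS exprD /G; ring.
  apply: ler_pM; rewrite ?powR_ge0//.
  - by have [_ /ltW] := hd _ (U_d _ _ Uj).
  - exact: powR_dyadic_le.
  apply: doubling_iter => i ij; have [] := hd (2 ^+ i * l) => //.
  rewrite mulr_gt0 ?exprn_gt0//=; have /andP[_ h] := U_d _ _ Uj;
    apply: le_lt_trans h.
  by rewrite ler_pM2r// ler_weXn2l ?ler1n// ltnW.
set mu := 2 ^+ j * l in js *.
have mu0 : 0 < mu by exact: lt_le_trans js.
have hpsi' x : partials_le N psi x e.
  exact: partials_le_mono (leq_maxr k N) (lexx e) (hpsi x).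
apply: (le_trans (hC2 mu psi e mu0 e0 vpsi hpsi')).
apply: (@le_trans _ _ (C3 * 2 ^+ (j * P) * G * e)); last first.
  by rewrite lerDr; exact: Ge0.
rewrite ler_pM2r//.
have smu : mu^-1 <= s^-1 by rewrite lef_pV2.
have b1 : mu ^- n <= s ^- n.
  by rewrite lef_pV2 ?posrE ?exprn_gt0// lerXn2r// nnegrE ltW.
have m4 : 0 <= 1 + 4 * mu by rewrite addr_ge0// mulr_ge0// ltW.
have i0 : 0 <= mu^-1 by rewrite invr_ge0 ltW.
have b2 : (1 + 4 * mu) ^+ N <= (s^-1 + 4) ^+ N * mu ^+ N.
  have h : 1 + 4 * mu <= (s^-1 + 4) * mu.
    by rewrite [leRHS]mulrDl lerD2r mulrC ler_pdivlMr// mul1r.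
  by rewrite -exprMn lerXn2r// nnegrE// (le_trans m4).
have b3 : (1 + mu^-1) ^+ N <= (1 + s^-1) ^+ N.
  by rewrite lerXn2r ?lerD2l// nnegrE addr_ge0// ltW.
(* The exponent is raised on purpose: mu^P = 2^(jP) l^P contains the power of [l] to be compared
   with l^alpha L(l). *)
have b4 : mu ^+ N <= s ^- a.+1 * mu ^+ P.
  rewrite /P exprD mulrCA ler_peMr ?exprn_ge0 ?(ltW mu0)// mulrC ler_pdivlMr
    ?exprn_gt0//.
  by rewrite mul1r lerXn2r// nnegrE ltW.
have b5 : mu ^+ P <= 2 ^+ (j * P) * (G / c).
  rewrite exprMn exprM ler_wpM2l ?exprn_ge0 ?(ltW j0)//.
  apply: (@le_trans _ _ (l ^+ a.+1)).
    by rewrite /P exprD ler_piMl ?exprn_ge0 ?(ltW l0)// exprn_ile1 ?(ltW l0).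
  rewrite exprSr /G -mulrA; apply: ler_pM; rewrite ?exprn_ge0 ?(ltW l0)//.
    by rewrite -(powR_mulrn a (ltW l0)) ger_powR// l0 l1.
  by rewrite ler_pdivlMr// mulrC.
have B : mu ^- n * (1 + 4 * mu) ^+ N * (1 + mu^-1) ^+ N <=
    s ^- n * ((s^-1 + 4) ^+ N * (s ^- a.+1 * (2 ^+ (j * P) * (G / c)))) * (1 +
      s^-1) ^+ N.
  have sa : 0 <= s ^- a.+1 by rewrite invr_ge0 exprn_ge0// ltW.
  have q : mu ^+ N <= s ^- a.+1 * (2 ^+ (j * P) * (G / c)).
    by apply: (le_trans b4); rewrite ler_wpM2l.
  have q2 : (1 + 4 * mu) ^+ N <= (s^-1 + 4) ^+ N * (s ^- a.+1 * (2 ^+ (j * P) *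
    (G / c))).
    by apply: (le_trans b2); rewrite ler_wpM2l ?exprn_ge0 ?addr_ge0 ?(ltW si0).
  have mn : 0 <= mu ^- n by rewrite invr_ge0 exprn_ge0// ltW.
  apply: ler_pM => //; [by rewrite mulr_ge0// exprn_ge0|by rewrite exprn_ge0//
    addr_ge0|].
  by apply: ler_pM => //; exact: exprn_ge0.
apply: (le_trans (ler_wpM2l (ltW C20) B)).
rewrite /C3 le_eqVlt; apply/orP; left; apply/eqP; ring.
Unshelve. all: by end_near. Qed.

Theorem proposition7p1 (R : realType) (n : nat)
  (E : completeNormedModType R[i]) (alpha : R) (L : R -> R)
  (f : tempered_distribution n E) :
  (slowly_varying_origin L ->
   quasi_bounded_D (restriction f) alpha L 0^'+ ->
   quasi_bounded_S f alpha L 0^'+) /\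
  (slowly_varying_infinity L ->
   quasi_bounded_D (restriction f) alpha L +oo ->
   quasi_bounded_S f alpha L +oo).
Proof.
by split; [exact: quasi_bounded_origin|exact: quasi_bounded_infinity].
Qed.
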